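(* Let $G=(V,E)$ be a finite connected graph with $n=|V|$, $m=|E|\ge1$ and maximum degree $\Delta$; let $0<\beta<\infty$, $x=\tanh\beta$, $\epsilon,\delta\in(0,1)$, and fix $k\in\mathbb{N}$. Let $(X_t)_{t\in\mathbb{N}}$ be the worm process on $G$ with parameter $x$ started from $X_0=\mathbf{0}$. Set $$\tau=\left\lceil 4\left(\log 2+\frac{\log(4\delta^{-1})}{m}\right)\Delta\,m^2\,n^4\right\rceil,\qquad N=\left\lceil 16\,\epsilon^{-2}(2+\epsilon)^2\delta^{-1}\Delta\,m\,n^6\,x^{-k}\right\rceil,$$ and, for $u,v\in V$, $$\hat S_0=\frac1N\sum_{t=\tau+1}^{\tau+N}\mathbf{1}_{\mathcal{C}_0}(X_t),\qquad \hat S_{uv}=\frac1N\sum_{t=\tau+1}^{\tau+N}\mathbf{1}_{\mathcal{C}_{uv}}(X_t),$$ both computed from the same realization of $(X_t)_{t\in\mathbb{N}}$. Then for any $u,v\in V$ with $d(u,v)\le k$: $\hat S_{uv}$ is an $(\epsilon/(2+\epsilon),\delta/2)$-approximation for $\pi_x(\mathcal{C}_{uv})$, $\hat S_0$ is an $(\epsilon/(2+\epsilon),\delta/2)$-approximation for $\pi_x(\mathcal{C}_0)$, and the estimator $$\frac n2\,\frac{\hat S_{uv}}{\hat S_0}$$ is an $(\epsilon,\delta)$-approximation for the zero-field Ising two-point correlation $\mathbb{E}_\beta(\sigma_u\sigma_v)$, in time $N+\tau=O(\epsilon^{-2}\delta^{-1}\Delta\,m\,n^6\,x^{-k})$. Consequently,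 for any fixed $k\in\mathbb{N}$, this construction provides a fully-polynomial randomized approximation scheme for the problem of computing the $k$-restricted Ising two-point correlation function $g_k:\{(u,v)\in V\times V:d(u,v)\le k\}\to\mathbb{R}$, $g_k(u,v)=\mathbb{E}_\beta(\sigma_u\sigma_v)$.
   Context: $d(v)$ is the degree of $v$ in $G$, and $d(u,v)$ is the graph distance between $u$ and $v$. The zero-field ferromagnetic Ising model on $G$ at inverse temperature $\beta$ is the probability measure on $\{-1,+1\}^V$ with $\mathbb{P}_\beta(\sigma)\propto\exp(\beta\sum_{ij\in E}\sigma_i\sigma_j)$; $\mathbb{E}_\beta$ is its expectation. For $A\subseteq E$, $\partial A\subseteq V$ denotes the set of vertices of odd degree in the spanning subgraph $(V,A)$. Let $\mathcal{C}_0=\{A\subseteq E:\partial A=\emptyset\}$, $\mathcal{C}_2=\{A\subseteq E:|\partial A|=2\}$, $\mathcal{C}_{uv}=\{A\subseteq E:\partial A=\{u,v\}\}$, $\mathcal{W}=\mathcal{C}_0\cup\mathcal{C}_2$; the empty edge set as an element of $\mathcal{W}$ is denoted $\mathbf{0}$. For $S\subseteq 2^E$, $\lambda_x(S)=\sum_{A\in S}x^{|A|}$. The Prokof'ev-Svistunov measure is the probability measure on $\mathcal{W}$ given by $\pi_x(A)=x^{|A|}\psi(A)/(n\lambda_x(\mathcal{C}_0)+2\lambda_x(\mathcal{C}_2))$, where $\psi(A)=n$ if $A\in\mathcal{C}_0$ and $\psi(A)=2$ if $A\in\mathcal{C}_2$. $\triangle$ is symmetric difference, and $A\triangle uv$ means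 $A\triangle\{uv\}$. The worm process with parameter $x\in(0,1)$ is the Markov chain on $\mathcal{W}$ with transition matrix $P_x$ whose off-diagonal entries are, for an edge $uv\in E$ and $A,\,A\triangle uv\in\mathcal{W}$: (i) if $A\in\mathcal{C}_0$: $P_x(A,A\triangle uv)=x^{\mathbf{1}(uv\notin A)}\frac{1}{2n}\left(\frac1{d(u)}+\frac1{d(v)}\right)$; (ii) if $A\triangle uv\in\mathcal{C}_0$: $P_x(A,A\triangle uv)=x^{\mathbf{1}(uv\notin A)}\frac14\left(\frac1{d(u)}+\frac1{d(v)}\right)$; (iii) if $A\in\mathcal{C}_2$, $A\triangle uv\in\mathcal{C}_2$ and $u\in\partial A$: $P_x(A,A\triangle uv)=\min\left(\frac{d(u)}{d(v)}x^{\mathbf{1}(uv\notin A)-\mathbf{1}(uv\in A)},1\right)\frac{1}{4d(u)}$. All other off-diagonal entries are zero, and the diagonal entries are determined by the rows summing to 1. A random quantity $\hat y$ is an $(\epsilon,\delta)$-approximation for $y$ if $|\hat y-y|\le\epsilon y$ with probability at least $1-\delta$. A fully-polynomial randomized approximation scheme for an Ising observable is a randomized algorithm which, for arbitrary choices of $(\epsilon,\delta)$, provides an $(\epsilon,\delta)$-approximation for the observable, and which runs in a time polynomial in $n$, $\epsilon^{-1}$ and $\delta^{-1}$. Time is measured here by the number $N+\tau$ of steps of the worm process.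
   Formalization: The claim on the estimator (n/2)Ŝ_uv/Ŝ_0 is restricted to u ≠ v: for u = v the class C_uu is empty, so the estimator is 0 while E(σ_u²) = 1. In the approximation scheme for g_k, the value 1 is returned when u = v. *)

(* Defs.v *)
From HB Require Import structures.
From mathcomp Require Import all_boot all_order all_algebra.
From mathcomp Require Import all_classical all_reals all_analysis.

Set Implicit Arguments.
Unset Strict Implicit.
Unset Printing Implicit Defensive.

Import Order.TTheory GRing.Theory Num.Theory.

Local Open Scope ring_scope.

Record sgraph := SGraph {
  vertex :> finType;
  adj : rel vertex;
  adj_sym : symmetric adj;
  adj_irrefl : irreflexive adj }.

Definition edges (G : sgraph) : {set {set G}} :=
  [set f : {set G} | [exists u : G, exists v : G, adj u v && (f == [set u; v])]].

Definition degree (G : sgraph) (v : G) : nat := #|[set w : G | adj v w]|.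

Definition max_degree (G : sgraph) : nat := \max_(v : G) degree v.

Definition connected_graph (G : sgraph) : Prop :=
  forall u v : G, connect (@adj G) u v.

(* The least l such that some walk of length l joins u to v; in a connected
   graph such an l < #|G| exists, so that the search over iota succeeds. *)
Definition gdist (G : sgraph) (u v : G) : nat :=
  find (fun l => [exists p : l.-tuple G,
                    path (@adj G) u p && (last u p == v)])
       (iota 0 #|G|).

Definition tanh (R : realType) (b : R) : R :=
  (expR b - expR (- b)) / (expR b + expR (- b)).

(* {-1,+1}^V is encoded by {ffun G -> bool}, true standing for +1; the edge
   {i,j} contributes \prod_(k in {i,j}) sigma_k = sigma_i sigma_j. *)
Definition spin (R : realType) (G : sgraph) (s : {ffun G -> bool}) (v : G) : R :=
  if s v then 1 else -1.

Definition ising_weight (R : realType) (G : sgraph) (beta : R)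
    (s : {ffun G -> bool}) : R :=
  expR (beta * \sum_(f in edges G) \prod_(i in f) spin R s i).

Definition ising_prob (R : realType) (G : sgraph) (beta : R)
    (s : {ffun G -> bool}) : R :=
  ising_weight beta s / \sum_(s' : {ffun G -> bool}) ising_weight beta s'.

Definition ising_expectation (R : realType) (G : sgraph) (beta : R)
    (F : {ffun G -> bool} -> R) : R :=
  \sum_(s : {ffun G -> bool}) ising_prob beta s * F s.

Definition two_point (R : realType) (G : sgraph) (beta : R) (u v : G) : R :=
  ising_expectation beta (fun s => spin R s u * spin R s v).

Definition boundary (G : sgraph) (A : {set {set G}}) : {set G} :=
  [set v : G | odd #|[set f in A | v \in f]|].

Definition C0 (G : sgraph) : {set {set {set G}}} :=
  [set A : {set {set G}} | (A \subset edges G) && (boundary A == finset.set0)].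

Definition C2 (G : sgraph) : {set {set {set G}}} :=
  [set A : {set {set G}} | (A \subset edges G) && (#|boundary A| == 2)].

(* Empty when u = v, since a boundary has even cardinality. *)
Definition Cuv (G : sgraph) (u v : G) : {set {set {set G}}} :=
  [set A : {set {set G}} | (A \subset edges G) && (boundary A == [set u; v])].

Definition worms (G : sgraph) : {set {set {set G}}} := C0 G :|: C2 G.

Definition worm (G : sgraph) := {A : {set {set G}} | A \in worms G}.

Lemma set0_worms (G : sgraph) : finset.set0 \in worms G.
Proof.
rewrite inE; apply/orP; left; rewrite inE finset.sub0set /=; apply/eqP/setP => v.
rewrite !inE; suff -> : [set f in (finset.set0 : {set {set G}}) | v \in f] = finset.set0.
  by rewrite cards0.
by apply/setP => f; rewrite !inE.
Qed.

Definition worm0 (G : sgraph) : worm G := exist _ finset.set0 (set0_worms G).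

Definition lambda (R : realType) (G : sgraph) (x : R)
    (S : {set {set {set G}}}) : R :=
  \sum_(A in S) x ^+ #|A|.

Definition psi (R : realType) (G : sgraph) (A : worm G) : R :=
  if val A \in C0 G then #|G|%:R else 2.

Definition ps_mass (R : realType) (G : sgraph) (x : R) (A : worm G) : R :=
  x ^+ #|val A| * psi R A
  / (#|G|%:R * lambda x (C0 G) + 2 * lambda x (C2 G)).

Definition ps_measure (R : realType) (G : sgraph) (x : R)
    (S : {set {set {set G}}}) : R :=
  \sum_(A : worm G | val A \in S) ps_mass x A.

Definition toggle (G : sgraph) (A : {set {set G}}) (u v : G) : {set {set G}} :=
  (A :\: [set [set u; v]]) :|: ([set [set u; v]] :\: A).

(* The entry P_x(A, toggle A u v).  The first two cases are symmetric in u and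
   v; in the last one u is the endpoint lying in the boundary of A. *)
Definition worm_rate (R : realType) (G : sgraph) (x : R) (A B : worm G)
    (u v : G) : R :=
  let du : R := (degree u)%:R in
  let dv : R := (degree v)%:R in
  let absent : nat := [set u; v] \notin val A in
  let present : nat := [set u; v] \in val A in
  if val A \in C0 G then
    x ^+ absent * (1 / (2 * #|G|%:R)) * (1 / du + 1 / dv)
  else if val B \in C0 G then
    x ^+ absent * (1 / 4) * (1 / du + 1 / dv)
  else
    Num.min (du / dv * (x ^+ absent / x ^+ present)) 1 * (1 / (4 * du)).

(* (u, v) orients the unique edge in which A and B differ, if there is one;
   when A and B are both in C2 the orientation is forced by u \in boundary A. *)
Definition worm_move (G : sgraph) (A B : worm G) (p : G * G) : bool :=
  [&& adj p.1 p.2, val B == toggle (val A) p.1 p.2 &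
      ((val A \in C2 G) && (val B \in C2 G)) ==> (p.1 \in boundary (val A))].

Definition worm_offdiag (R : realType) (G : sgraph) (x : R) (A B : worm G) : R :=
  if [pick p | worm_move A B p] is Some p then worm_rate x A B p.1 p.2 else 0.

Definition worm_matrix (R : realType) (G : sgraph) (x : R) (A B : worm G) : R :=
  if A == B then 1 - \sum_(B' : worm G | B' != A) worm_offdiag x A B'
  else worm_offdiag x A B.

(* Probability that the chain started at worm0 follows w_0, ..., w_T. *)
Definition traj_prob (R : realType) (G : sgraph) (x : R) (T : nat)
    (w : nat -> worm G) : R :=
  (w 0%N == worm0 G)%:R * \prod_(0 <= t < T) worm_matrix x (w t) (w t.+1).

Definition is_worm_process (R : realType) (d : measure_display)
    (Om : measurableType d) (P : probability Om R) (G : sgraph) (x : R)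
    (X : nat -> Om -> worm G) : Prop :=
  (forall t a, measurable [set o | X t o = a]%classic) /\
  (forall (T : nat) (w : nat -> worm G),
     P [set o | forall t, (t <= T)%N -> X t o = w t]%classic = (traj_prob x T w)%:E).

Definition burn_in (R : realType) (G : sgraph) (delta : R) : nat :=
  `|Num.ceil (4 * (ln 2 + ln (4 * delta^-1) / #|edges G|%:R)
              * (max_degree G)%:R * #|edges G|%:R ^+ 2 * #|G|%:R ^+ 4)|%N.

Definition sample_size (R : realType) (G : sgraph) (x eps delta : R)
    (k : nat) : nat :=
  `|Num.ceil (16 * eps ^- 2 * (2 + eps) ^+ 2 * delta^-1 * (max_degree G)%:R
              * #|edges G|%:R * #|G|%:R ^+ 6 * x ^- k)|%N.

Definition time_average (R : realType) (G : sgraph) (tau N : nat)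
    (S : {set {set {set G}}}) (w : nat -> worm G) : R :=
  N%:R^-1 * \sum_(tau.+1 <= t < (tau + N).+1) (val (w t) \in S)%:R.

Definition worm_estimator (R : realType) (G : sgraph) (tau N : nat) (u v : G)
    (w : nat -> worm G) : R :=
  #|G|%:R / 2 * (time_average R tau N (Cuv u v) w
                 / time_average R tau N (C0 G) w).

Definition is_approximation (R : realType) (Om : Type) (Pr : set Om -> \bar R)
    (Y : Om -> R) (eps delta y : R) : Prop :=
  ((1 - delta)%:E <= Pr [set o | (`|Y o - y| <= eps * y)%R]%classic)%E.

(* A randomized computation with finitely many outcomes; steps is its running
   time, counted in transitions of the simulated chain. *)
Record randomized_run (R : realType) := RandomizedRun {
  outcome : finType;
  weight : outcome -> R;
  output : outcome -> R;
  steps : nat }.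

Definition run_prob (R : realType) (r : randomized_run R)
    (S : set (outcome r)) : \bar R :=
  (\sum_(o | o \in S) weight o)%:E.

Definition well_defined_run (R : realType) (r : randomized_run R) : Prop :=
  (forall o : outcome r, 0 <= weight o) /\ \sum_(o : outcome r) weight o = 1.

(* The polynomial in three variables is an element of R[Z][Y][X]. *)
Definition is_fpras (R : realType) (I : Type) (size_of : I -> nat)
    (observable : I -> R) (alg : I -> R -> R -> randomized_run R) : Prop :=
  (forall (i : I) (eps delta : R), 0 < eps < 1 -> 0 < delta < 1 ->
     well_defined_run (alg i eps delta) /\
     is_approximation (@run_prob R (alg i eps delta))
       (@output R (alg i eps delta)) eps delta (observable i)) /\
  (exists p : {poly {poly {poly R}}},
     forall (i : I) (eps delta : R), 0 < eps < 1 -> 0 < delta < 1 ->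
       (steps (alg i eps delta))%:R
         <= p.[((size_of i)%:R)%:P%:P].[(eps^-1)%:P].[delta^-1]).

Record restricted_pair (k : nat) := RestrictedPair {
  rp_graph : sgraph;
  rp_connected : connected_graph rp_graph;
  rp_edge : (0 < #|edges rp_graph|)%N;
  rp_u : rp_graph;
  rp_v : rp_graph;
  rp_dist : (gdist rp_u rp_v <= k)%N }.

Definition rp_size (k : nat) (i : restricted_pair k) : nat := #|rp_graph i|.

Definition restricted_correlation (R : realType) (k : nat) (beta : R)
    (i : restricted_pair k) : R :=
  two_point beta (rp_u i) (rp_v i).

(* The algorithm simulates tau + N steps of the worm process from worm0; an
   outcome is the trajectory X_0, ..., X_(tau + N).  On the diagonal, where Cuv
   is empty and the correlation is E[sigma_u ^ 2] = 1, it returns 1. *)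
Definition worm_algorithm (R : realType) (k : nat) (beta : R)
    (i : restricted_pair k) (eps delta : R) : randomized_run R :=
  let G := rp_graph i in
  let x := tanh beta in
  let tau := burn_in G delta in
  let N := sample_size G x eps delta k in
  let path_of (w : {ffun 'I_(tau + N).+1 -> worm G}) (t : nat) := w (inord t) in
  @RandomizedRun R {ffun 'I_(tau + N).+1 -> worm G}
    (fun w => traj_prob x (tau + N) (path_of w))
    (fun w => if rp_u i == rp_v i then 1
              else worm_estimator R tau N (rp_u i) (rp_v i) (path_of w))
    (N + tau).

(* Main.v *)
Require Import Defs.
From HB Require Import structures.
From mathcomp Require Import all_boot all_order all_algebra.
From mathcomp Require Import all_classical all_reals all_analysis.
From mathcomp Require Import ring lra.

Set Implicit Arguments.
Unset Strict Implicit.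
Unset Printing Implicit Defensive.

Import Order.TTheory GRing.Theory Num.Theory.

Local Open Scope ring_scope.

(** The worm process is lazy and reversible for the Prokof'ev-Svistunov measure
    pi, so everything follows from a Poincare inequality with constant
    T = 4 Delta m n^2 ([worm_poincare]).

    Canonical paths give it.  For a closed edge set F and a worm A, the
    difference D = F + A (symmetric difference) is again a worm, and a nonempty
    worm always contains an edge whose removal leaves a worm
    ([removable_edge]).  Removing the edges of D one at a time yields remainders
    S, all of them worms, and A = F + D is joined to F through the sets F + S
    by at most m transitions.  When a transition toggles e at the worm B = F + S,
    the weights satisfy |F| + |F + D| = |M| + |D + M|, where M is the union of B
    and {e} ([exchange_card]).  Here x^|M| is at most 2 Delta times the
    unnormalized stationary flow through the transition ([worm_flow_ge]), and D
    determines F once the transition is known.  The load of a transition is thus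
    a sum of x^|D + M| over all worms D, with weight n or 2.  By the
    high-temperature expansion the generating function of the edge sets with a
    prescribed boundary is largest for the empty boundary ([lambda_bclass_le]),
    so the load is at most n^2 lambda(C_0) ([sum_psi_shift]).  Comparing f with
    its value at F, rather than with its mean, only increases the variance;
    averaging over F in C_0 with weight x^|F| therefore suffices, and
    lambda(C_0) cancels.

    Laziness makes one step contract the squared norm of f by at least its
    Dirichlet form ([step_contracts]), hence mean-zero functions decay at rate
    1 - 1/(2T) ([iter_step_decay]).  The second moment of a stationary sum of N
    terms is then at most 4 T N times the variance of one term
    ([stationary_second_moment]), and the probability of a deviation after the
    burn-in exceeds its stationary value by at most the decay factor divided by
    the square root of pi(0) >= 2^-m ([deviation_bound]).

    The high-temperature expansion also identifies the two-point function with
    lambda(C_uv) / lambda(C_0) ([two_pointE]), which is at least x^k for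
    d(u,v) <= k because toggling the edges of a walk from u to v costs a factor x each
    ([lambda_walk]).  With lambda(C_uv) <= lambda(C_0) this bounds pi(C_0) and
    pi(C_uv) from below by 2 x^k / n^2, and the two relative errors
    eps / (2 + eps) combine to eps in the quotient ([ratio_error]).  A
    probability on trajectories is a finite sum of trajectory weights
    ([process_prob]), which treats the process on an abstract probability space
    and the simulated one alike. *)

(** * Lazy reversible chains *)

Lemma weighted_cauchy_schwarz (R : realFieldType) (I : finType) (Q : pred I) (p y : I -> R) :
  (forall i, Q i -> 0 <= p i) ->
  (\sum_(i | Q i) p i * y i) ^+ 2
    <= (\sum_(i | Q i) p i) * (\sum_(i | Q i) p i * y i ^+ 2).
Proof.
move=> p0; set q := \sum_(i | Q i) p i; set s := \sum_(i | Q i) p i * y i.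
set S := \sum_(i | Q i) p i * y i ^+ 2.
have q0 : 0 <= q by apply: sumr_ge0.
have S0 : 0 <= S by apply: sumr_ge0 => i Qi; rewrite mulr_ge0 ?sqr_ge0 ?p0.
have [q_eq0|q_neq0] := eqVneq q 0.
  have pz i : Q i -> p i = 0.
    move=> Qi; move/eqP: q_eq0; rewrite psumr_eq0 // => /allP /(_ i).
    by rewrite mem_index_enum Qi => /(_ isT)/eqP.
  have -> : s = 0 by rewrite /s big1 // => i Qi; rewrite pz ?mul0r.
  by rewrite expr0n mulr_ge0.
have expand (c d : R) : \sum_(i | Q i) p i * (c * y i - d) ^+ 2
    = c ^+ 2 * (\sum_(i | Q i) p i * y i ^+ 2)
      - 2 * c * d * (\sum_(i | Q i) p i * y i) + d ^+ 2 * (\sum_(i | Q i) p i).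
  rewrite !mulr_sumr -sumrN -!big_split /=.
  by apply: eq_bigr => i _; ring.
(* the variance of y, scaled by q^2 to avoid a division *)
have : 0 <= \sum_(i | Q i) p i * (q * y i - s) ^+ 2.
  by apply: sumr_ge0 => i Qi; rewrite mulr_ge0 ?sqr_ge0 ?p0.
rewrite expand -/q -/s -/S.
have -> : q ^+ 2 * S - 2 * q * s * s + s ^+ 2 * q = q * (q * S - s ^+ 2) by ring.
by rewrite pmulr_rge0 ?subr_ge0 // lt_def q_neq0.
Qed.

Lemma sqr_sum_le (R : realFieldType) (I : finType) (A : {set I}) (y : I -> R) :
  (\sum_(i in A) y i) ^+ 2 <= #|A|%:R * \sum_(i in A) y i ^+ 2.
Proof.
have := @weighted_cauchy_schwarz R I (mem A) (fun=> 1) y (fun _ _ => ler01).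
rewrite (eq_bigr y) => [|i _]; last by rewrite mul1r.
rewrite [X in _ <= _ * X](eq_bigr (fun i => y i ^+ 2)) => [|i _]; last by rewrite mul1r.
by rewrite sumr_const.
Qed.

Section Chain.
Context (R : realFieldType) (W : finType) (P : W -> W -> R) (pi : W -> R).

Definition step (f : W -> R) (a : W) : R := \sum_b P a b * f b.
Definition avg (f : W -> R) : R := \sum_a pi a * f a.
Definition inner (f g : W -> R) : R := avg (fun a => f a * g a).
Definition dirichlet (f : W -> R) : R :=
  2^-1 * \sum_a \sum_b pi a * P a b * (f a - f b) ^+ 2.

(** The mean of F (X_1, ..., X_T) over the chain started at X_0 = a. *)
Fixpoint path_mean (T : nat) (F : seq W -> R) (a : W) : R :=
  if T is T'.+1 then \sum_b P a b * path_mean T' (fun p => F (b :: p)) b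
  else F [::].

Hypothesis P_ge0 : forall a b, 0 <= P a b.
Hypothesis P_sum1 : forall a, \sum_b P a b = 1.
Hypothesis pi_ge0 : forall a, 0 <= pi a.
Hypothesis pi_sum1 : \sum_a pi a = 1.
Hypothesis balance : forall a b, pi a * P a b = pi b * P b a.

Lemma avg_step f : avg (step f) = avg f.
Proof.
rewrite /avg /step; under eq_bigr do rewrite mulr_sumr.
rewrite exchange_big /=; apply: eq_bigr => b _.
under eq_bigr => a _ do rewrite mulrA balance -mulrA mulrCA.
by rewrite -mulr_suml -[in RHS](mul1r (f b)) -(P_sum1 b); ring.
Qed.

Lemma inner_ge0 f : 0 <= inner f f.
Proof. by apply: sumr_ge0 => a _; rewrite mulr_ge0 // -expr2 sqr_ge0. Qed.

Lemma avg_iter_step t f : avg (iter t step f) = avg f.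
Proof. by elim: t => //= t IH; rewrite avg_step. Qed.

(** Only the mass 1 - p a <= 1/2 moves away from a, so by Cauchy-Schwarz the
    squared mean displacement of f is at most half of its mean square; the
    other half remains as variance. *)
Lemma lazy_row_variance (p : W -> R) (a : W) (f : W -> R) :
  (forall b, 0 <= p b) -> \sum_b p b = 1 -> 2^-1 <= p a ->
  2^-1 * \sum_b p b * (f a - f b) ^+ 2
    <= \sum_b p b * f b ^+ 2 - (\sum_b p b * f b) ^+ 2.
Proof.
move=> p0 p1 pa.
set q := \sum_(b | b != a) p b.
set s := \sum_(b | b != a) p b * (f b - f a).
set S := \sum_(b | b != a) p b * (f b - f a) ^+ 2.
have q0 : 0 <= q by apply: sumr_ge0.
have S0 : 0 <= S by apply: sumr_ge0 => b _; rewrite mulr_ge0 ?sqr_ge0.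
have pq : p a + q = 1 by rewrite -p1 (bigD1 a).
have E1 : \sum_b p b * (f a - f b) ^+ 2 = S.
  rewrite (bigD1 a) //= subrr expr0n mulr0 add0r; apply: eq_bigr => b _; ring.
have E2 : \sum_b p b * f b = f a + s.
  have -> : f a + s = p a * f a + (q * f a + s) by rewrite addrA -mulrDl pq mul1r.
  rewrite (bigD1 a) //=; congr (_ + _).
  by rewrite mulr_suml -big_split /=; apply: eq_bigr => b _; ring.
have E3 : \sum_b p b * f b ^+ 2 = f a ^+ 2 + 2 * f a * s + S.
  have -> : f a ^+ 2 + 2 * f a * s + S
      = p a * f a ^+ 2 + (q * f a ^+ 2 + (2 * f a * s + S)).
    by rewrite !addrA -mulrDl pq mul1r.
  rewrite (bigD1 a) //=; congr (_ + _).
  rewrite /q /s /S mulr_suml mulr_sumr -!big_split /=.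
  by apply: eq_bigr => b _; ring.
have CS : s ^+ 2 <= q * S by apply: weighted_cauchy_schwarz.
rewrite E1 E2 E3.
have : q * S <= 2^-1 * S by apply: ler_wpM2r => //; lra.
by move: CS; set x := q * S; nra.
Qed.

Hypothesis lazy : forall a, 2^-1 <= P a a.

(** By stationarity the difference of the two norms is the average over a of the
    variance of f under the row P a. *)
Lemma step_contracts f : inner (step f) (step f) <= inner f f - dirichlet f.
Proof.
have -> : dirichlet f
    = \sum_a pi a * (2^-1 * \sum_b P a b * (f a - f b) ^+ 2).
  rewrite /dirichlet mulr_sumr; apply: eq_bigr => a _.
  rewrite [RHS]mulrCA; congr (_ * _); rewrite mulr_sumr.
  by apply: eq_bigr => b _; rewrite -mulrA.
have -> : inner f f = avg (step (fun b => f b ^+ 2)).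
  by rewrite avg_step; apply: eq_bigr => a _; rewrite expr2.
rewrite -sumrB; apply: ler_sum => a _; rewrite -mulrBr -expr2.
apply: ler_wpM2l => //; rewrite lerBrDl -lerBrDr.
exact: lazy_row_variance.
Qed.

Context (T : R).
Hypothesis T_gt0 : 1 <= T.
Hypothesis poincare : forall f, avg f = 0 -> inner f f <= T * dirichlet f.

(* rho ^+ 2 is at least the factor 1 - 1/T that the Poincare inequality gives
   for squared norms, so that rho is a rate for the norms themselves. *)
Let rho : R := 1 - (2 * T)^-1.

Lemma rho_ge0 : 0 <= rho.
Proof. by rewrite subr_ge0 invf_le1; move: T_gt0; lra. Qed.

Lemma iter_step_decay t f : avg f = 0 ->
  inner (iter t step f) (iter t step f) <= (rho ^+ t) ^+ 2 * inner f f.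
Proof.
move=> f0; elim: t => [|t IH]; first by rewrite expr0 expr1n mul1r.
rewrite iterS; set g := iter t step f in IH *.
have g0 : avg g = 0 by rewrite avg_iter_step.
have T0 : 0 < T by move: T_gt0; lra.
have D : inner g g / T <= dirichlet g by rewrite ler_pdivrMr // mulrC poincare.
apply: le_trans (step_contracts g) _.
have -> : (rho ^+ t.+1) ^+ 2 * inner f f = rho ^+ 2 * ((rho ^+ t) ^+ 2 * inner f f).
  by rewrite (exprS rho t); ring.
apply: (@le_trans _ _ (rho ^+ 2 * inner g g)); last by rewrite ler_wpM2l ?sqr_ge0.
apply: (@le_trans _ _ (inner g g - inner g g / T)); first by rewrite lerD2l lerN2.
have -> : inner g g - inner g g / T = (1 - T^-1) * inner g g by ring.
apply: ler_wpM2r; first exact: inner_ge0.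
have -> : rho ^+ 2 = 1 - T^-1 + (2 * T)^-1 ^+ 2 by rewrite /rho; field; lra.
by rewrite lerDl sqr_ge0.
Qed.

(** Cauchy-Schwarz without square roots: the product f g is bounded by
    (c f^2 + g^2 / c) / 2, with the decay factor itself as c. *)
Lemma inner_iter_step r f : avg f = 0 ->
  inner f (iter r step f) <= rho ^+ r * inner f f.
Proof.
move=> f0; have := iter_step_decay r f0; set g := iter r step f => H.
have c0 : 0 <= rho ^+ r by rewrite exprn_ge0 // rho_ge0.
have young (c : R) : 0 < c ->
   2 * inner f g <= c * inner f f + c^-1 * inner g g.
  move=> cp; rewrite /inner /avg !mulr_sumr -big_split; apply: ler_sum => a _ /=.
  have -> : c * (pi a * (f a * f a)) + c^-1 * (pi a * (g a * g a))
     = 2 * (pi a * (f a * g a)) + pi a * (c^-1 * (c * f a - g a) ^+ 2).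
    by field; lra.
  by rewrite lerDl mulr_ge0 // mulr_ge0 ?sqr_ge0 // invr_ge0 ltW.
have [c_eq0|c_neq0] := eqVneq (rho ^+ r) 0.
  (* a null contraction factor forces g to vanish in the mean square *)
  have gg : inner g g = 0.
    by apply/eqP; rewrite eq_le inner_ge0 andbT; move: H; rewrite c_eq0 expr0n mul0r.
  rewrite c_eq0 mul0r; apply/ler_addgt0Pr => e e0; rewrite add0r.
  have ff1 : 0 < inner f f + 1 by have := inner_ge0 f; lra.
  have := young (e / (inner f f + 1)) (divr_gt0 e0 ff1).
  rewrite gg mulr0 addr0.
  have : e / (inner f f + 1) * inner f f <= e.
    rewrite mulrAC ler_pdivrMr // ler_wpM2l ?(ltW e0) //; have := inner_ge0 f; lra.
  by move: e0; lra.
have cp : 0 < rho ^+ r by rewrite lt_def c_neq0.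
have := young _ cp.
have : (rho ^+ r)^-1 * inner g g <= rho ^+ r * inner f f.
  by rewrite mulrC ler_pdivrMr // mulrAC -expr2.
by lra.
Qed.

Lemma path_mean_ext T' F F' a : (forall p, size p = T' -> F p = F' p) ->
  path_mean T' F a = path_mean T' F' a.
Proof.
elim: T' F F' a => [|t IH] F F' a H /=; first exact: H.
by apply: eq_bigr => b _; congr (_ * _); apply: IH => p sp; apply: H; rewrite /= sp.
Qed.

Lemma path_mean_le T' F F' a : (forall p, size p = T' -> F p <= F' p) ->
  path_mean T' F a <= path_mean T' F' a.
Proof.
elim: T' F F' a => [|t IH] F F' a H /=; first exact: H.
apply: ler_sum => b _; apply: ler_wpM2l; first exact: P_ge0.
by apply: IH => p sp; apply: H; rewrite /= sp.
Qed.

Lemma path_meanD T' F F' a :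
  path_mean T' (fun p => F p + F' p) a = path_mean T' F a + path_mean T' F' a.
Proof.
elim: T' F F' a => [|t IH] F F' a //=.
by rewrite -big_split /=; apply: eq_bigr => b _; rewrite IH mulrDr.
Qed.

Lemma path_meanZ T' c F a :
  path_mean T' (fun p => c * F p) a = c * path_mean T' F a.
Proof.
elim: T' F a => [|t IH] F a //=.
by rewrite mulr_sumr; apply: eq_bigr => b _; rewrite IH mulrCA.
Qed.

Lemma path_mean_cst T' c a : path_mean T' (fun=> c) a = c.
Proof.
elim: T' a => [|t IH] a //=.
by under eq_bigr do rewrite IH; rewrite -mulr_suml P_sum1 mul1r.
Qed.

(** The Markov property: a functional of the path after time t is, given the
    first t steps, a function of the state at time t. *)
Lemma path_mean_drop t N F a :
  path_mean (t + N) (fun p => F (drop t p)) a = iter t step (path_mean N F) a.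
Proof.
elim: t a => [|t IH] a; first by apply: path_mean_ext => p _; rewrite drop0.
by rewrite addSn /=; apply: eq_bigr => b _; rewrite -IH.
Qed.

Lemma path_mean_sum N f a :
  path_mean N (fun p => \sum_(b <- p) f b) a
  = \sum_(r < N) iter r.+1 step f a.
Proof.
elim: N a => [|N IH] a /=; first by rewrite big_nil big_ord0.
rewrite big_ord_recl /=.
transitivity (\sum_b P a b * (f b + \sum_(r < N) iter r.+1 step f b)).
  apply: eq_bigr => b _; rewrite -IH; congr (_ * _).
  rewrite -[f b](path_mean_cst N _ b) -path_meanD; apply: path_mean_ext => p _.
  by rewrite big_cons.
transitivity (\sum_b (P a b * f b + \sum_(r < N) P a b * iter r.+1 step f b)).
  by apply: eq_bigr => b _; rewrite mulrDr mulr_sumr.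
by rewrite big_split /= exchange_big.
Qed.

(** Stationarity makes the second moment grow at each step by the variance of
    f plus twice the sum of its autocovariances, which decay geometrically. *)
Lemma stationary_second_moment N f : avg f = 0 ->
  avg (path_mean N (fun p => (\sum_(b <- p) f b) ^+ 2))
    <= N%:R * (4 * T * inner f f).
Proof.
move=> f0; elim: N => [|N IH].
  by rewrite /avg big1 ?mul0r // => a _ /=; rewrite big_nil expr0n mulr0.
have -> : avg (path_mean N.+1 (fun p => (\sum_(b <- p) f b) ^+ 2))
  = avg (step (fun b => f b * f b + 2 * (f b * \sum_(r < N) iter r.+1 step f b)
       + path_mean N (fun p => (\sum_(b <- p) f b) ^+ 2) b)).
  apply: eq_bigr => a _; congr (_ * _); apply: eq_bigr => b _; congr (_ * _).
  rewrite -path_mean_sum mulrA -path_meanZ.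
  rewrite -[f b * f b](path_mean_cst N _ b) -!path_meanD.
  apply: path_mean_ext => p _; rewrite big_cons; ring.
rewrite avg_step.
have -> : avg (fun b => f b * f b + 2 * (f b * \sum_(r < N) iter r.+1 step f b)
       + path_mean N (fun p => (\sum_(b <- p) f b) ^+ 2) b)
  = inner f f + 2 * \sum_(r < N) inner f (iter r.+1 step f)
    + avg (path_mean N (fun p => (\sum_(b <- p) f b) ^+ 2)).
  rewrite /inner /avg exchange_big /= mulr_sumr -!big_split /=.
  by apply: eq_bigr => b _; rewrite !mulrDr -!mulr_sumr; ring.
have -> : N.+1%:R * (4 * T * inner f f) = 4 * T * inner f f + N%:R * (4 * T * inner f f).
  by rewrite -[N.+1%:R]natr1; ring.
apply: lerD => //.
have ff := inner_ge0 f.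
have geo : \sum_(r < N) rho ^+ r.+1 <= 2 * T - 1.
  have E : (1 - rho) * \sum_(r < N) rho ^+ r.+1 = rho - rho ^+ N.+1.
    elim: (N) => [|M IHM]; first by rewrite big_ord0 expr1 subrr mulr0.
    by rewrite big_ord_recr /= mulrDr IHM [rho ^+ M.+2]exprS; ring.
  have R1 : 1 - rho = (2 * T)^-1 by rewrite /rho; ring.
  have T0 : 0 < 2 * T by move: T_gt0; lra.
  have : (2 * T)^-1 * \sum_(r < N) rho ^+ r.+1 <= rho.
    by rewrite -R1 E gerBl exprn_ge0 // rho_ge0.
  rewrite mulrC ler_pdivrMr //; move/le_trans; apply.
  by rewrite /rho mulrBl mul1r mulVf ?gt_eqF.
have : \sum_(r < N) inner f (iter r.+1 step f) <= (2 * T - 1) * inner f f.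
  apply: le_trans (ler_wpM2r ff geo); rewrite mulr_suml.
  by apply: ler_sum => r _; apply: inner_iter_step.
by move: ff; nra.
Qed.

(** Deviation of the empirical frequency of S after a burn-in t: the deviation
    probability h of a run of length N has stationary mean at most the
    Chebyshev bound, and P^t h differs from that mean at a0 by at most the
    L2 contraction factor divided by the square root of pi a0. *)
Lemma deviation_bound (S : pred W) (t N : nat) (a0 : W) (eta d : R) :
  let q := avg (fun a => (S a)%:R) in
  0 < eta -> (0 < N)%N -> 0 <= d -> (rho ^+ t) ^+ 2 <= pi a0 * d ^+ 2 -> 0 < pi a0 ->
  path_mean (t + N)
     (fun p => (eta < `|N%:R^-1 * \sum_(b <- drop t p) (S b)%:R - q|)%R%:R) a0
   <= d + 4 * T * q / (N%:R * eta ^+ 2).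
Proof.
move=> q eta0 N0 d0 Hd pa0.
set F := fun p : seq W => (eta < `|N%:R^-1 * \sum_(b <- p) (S b)%:R - q|)%R%:R : R.
rewrite (path_mean_drop t N F).
set h := path_mean N F.
have h0 a : 0 <= h a.
  by rewrite -(path_mean_cst N 0 a); apply: path_mean_le => p _; rewrite ler0n.
have h1 a : h a <= 1.
  by rewrite -(path_mean_cst N 1 a); apply: path_mean_le => p _; rewrite lern1 leq_b1.
pose f := fun a => (S a)%:R - q.
have N0R : 0 < (N%:R : R) by rewrite ltr0n.
have f0 : avg f = 0.
  rewrite /avg /f; under eq_bigr do rewrite mulrBr.
  by rewrite big_split /= sumrN -mulr_suml pi_sum1 mul1r subrr.
have ff : inner f f <= q.
  have qE : q = \sum_a pi a * (S a)%:R by [].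
  rewrite /inner /avg /f.
  have -> : \sum_a pi a * (((S a)%:R - q) * ((S a)%:R - q))
      = \sum_a pi a * (S a)%:R - q * q.
    clearbody q.
    have -> : q * q = 2 * q * (\sum_a pi a * (S a)%:R) - (\sum_a pi a) * (q * q).
      by rewrite pi_sum1 -qE; ring.
    rewrite mulr_sumr mulr_suml -!sumrB.
    by apply: eq_bigr => a _; case: (S a) => /=; ring.
  by rewrite gerBl -expr2 sqr_ge0.
have cheb : avg h <= 4 * T * q / (N%:R * eta ^+ 2).
  have : avg h <= (N%:R ^+ 2 * eta ^+ 2)^-1 * (N%:R * (4 * T * inner f f)).
    apply: (@le_trans _ _ (avg (path_mean N (fun p =>
        (N%:R ^+ 2 * eta ^+ 2)^-1 * (\sum_(b <- p) f b) ^+ 2)))); last first.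
      rewrite /avg; under eq_bigr do rewrite path_meanZ mulrCA.
      by rewrite -mulr_sumr ler_wpM2l ?stationary_second_moment // invr_ge0
         mulr_ge0 ?sqr_ge0.
    apply: ler_sum => a _; apply: ler_wpM2l => //; apply: path_mean_le => p sp.
    rewrite /F; case: ltP => [H|_] /=; last first.
      by rewrite mulr_ge0 ?sqr_ge0 // invr_ge0 mulr_ge0 ?sqr_ge0.
    have E : \sum_(b <- p) f b = N%:R * (N%:R^-1 * \sum_(b <- p) (S b)%:R - q).
      rewrite mulrBr mulrA mulfV ?gt_eqF // mul1r /f sumrB; congr (_ - _).
      by rewrite big_const_seq count_predT sp iter_addr_0 mulr_natl.
    rewrite mulrC ler_pdivlMr ?mulr_gt0 ?exprn_gt0 // mul1r E exprMn.
    rewrite ler_wpM2l ?sqr_ge0 // -[leRHS]real_normK ?num_real //.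
    by rewrite ler_pXn2r // ?nnegrE ?normr_ge0 // ltW.
  move/le_trans; apply.
  have -> : (N%:R ^+ 2 * eta ^+ 2)^-1 * (N%:R * (4 * T * inner f f))
     = 4 * T * inner f f / (N%:R * eta ^+ 2).
    by field; rewrite !gt_eqF.
  apply: ler_wpM2r; first by rewrite invr_ge0 mulr_ge0 ?sqr_ge0 ?(ltW N0R).
  by apply: ler_wpM2l => //; move: T_gt0; lra.
pose g := fun a => h a - avg h.
have g0 : avg g = 0.
  rewrite {1}/avg /g; under eq_bigr do rewrite mulrBr.
  by rewrite big_split /= sumrN -mulr_suml pi_sum1 mul1r subrr.
have gg : inner g g <= 1.
  have h01 : 0 <= avg h <= 1.
    apply/andP; split; first by apply: sumr_ge0 => a _; rewrite mulr_ge0.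
    by rewrite -pi_sum1; apply: ler_sum => a _; rewrite ler_piMr.
  rewrite -pi_sum1 /inner; apply: ler_sum => a _; rewrite ler_piMr //.
  rewrite /g -expr2 -real_normK ?num_real //; apply: exprn_ile1 => //.
  by rewrite ler_norml; move: (h0 a) (h1 a) h01 => ? ? /andP[]; lra.
have split : iter t step h a0 = iter t step g a0 + avg h.
  elim: (t) a0 {pa0 Hd} => [|t' IH] a /=; first by rewrite /g subrK.
  rewrite /step; under eq_bigr do rewrite IH mulrDr.
  by rewrite big_split /= -mulr_suml P_sum1 mul1r.
rewrite split; apply: lerD => //.
have K : pi a0 * (iter t step g a0) ^+ 2 <= pi a0 * d ^+ 2.
  apply: le_trans Hd; apply: (@le_trans _ _ (inner (iter t step g) (iter t step g))).
    rewrite /inner /avg (bigD1 a0) //= -expr2 lerDl.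
    by apply: sumr_ge0 => a _; rewrite mulr_ge0 // -expr2 sqr_ge0.
  apply: le_trans (iter_step_decay t g0) _.
  by rewrite ler_piMr ?sqr_ge0.
rewrite ler_pM2l // in K.
by apply: le_trans (ler_norm _) _; rewrite -(ler_pXn2r (n:=2)) ?nnegrE ?normr_ge0 // real_normK ?num_real.
Qed.

(** Summing over all trajectories of N steps with their product weights is the
    same as conditioning on one step at a time. *)
Lemma sum_trajectories N (F : {ffun 'I_N.+1 -> W} -> R) a :
  \sum_(w : {ffun 'I_N.+1 -> W}) (w (inord 0) == a)%:R
     * \prod_(0 <= t < N) P (w (inord t)) (w (inord t.+1)) * F w
  = path_mean N (fun p => F [ffun i : 'I_N.+1 => nth a (a :: p) i]) a.
Proof.
elim: N F a => [|N IH] F a.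
  pose c (b : W) : {ffun 'I_1 -> W} := [ffun=> b].
  rewrite (reindex c) /=; last first.
    exists (fun w => w ord0) => [b _|w _]; first by rewrite ffunE.
    by apply/ffunP => i; rewrite ffunE [i]ord1.
  rewrite (bigD1 a) //= [X in _ + X]big1 => [|b ba]; last first.
    by rewrite ffunE (negbTE ba) !mul0r.
  rewrite ffunE eqxx big_geq // !mul1r addr0; congr F.
  by apply/ffunP => i; rewrite !ffunE [i]ord1.
pose fcons (bw : W * {ffun 'I_N.+1 -> W}) : {ffun 'I_N.+2 -> W} :=
  [ffun i => if unlift ord0 i is Some j then bw.2 j else bw.1].
have fcons0 b w : fcons (b, w) (inord 0) = b.
  rewrite ffunE; have -> : inord 0 = ord0 :> 'I_N.+2 by apply: val_inj; rewrite /= inordK.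
  by rewrite unlift_none.
have fconsS b w t : (t < N.+1)%N -> fcons (b, w) (inord t.+1) = w (inord t).
  move=> tN; rewrite ffunE.
  have -> : inord t.+1 = lift ord0 (inord t : 'I_N.+1) :> 'I_N.+2.
    by apply: val_inj; rewrite /= !inordK.
  by rewrite liftK.
rewrite (reindex fcons) /=; last first.
  exists (fun w => (w ord0, [ffun j => w (lift ord0 j)])) => [[b w] _|w _].
    congr (_, _); first by rewrite ffunE unlift_none.
    by apply/ffunP => j; rewrite !ffunE liftK.
  apply/ffunP => i; rewrite ffunE /=.
  by case: unliftP => [j ->|->]; rewrite ?ffunE.
rewrite -(pair_bigA _ (fun b w => (fcons (b, w) (inord 0) == a)%:R
   * \prod_(0 <= t < N.+1) P (fcons (b, w) (inord t)) (fcons (b, w) (inord t.+1))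
   * F (fcons (b, w)))) /=.
rewrite (bigD1 a) //= [X in _ + X]big1 ?addr0 => [|b ba]; last first.
  by apply: big1 => w _; rewrite fcons0 (negbTE ba) !mul0r.
transitivity (\sum_c \sum_(w : {ffun 'I_N.+1 -> W}) P a c * ((w (inord 0) == c)%:R
   * \prod_(0 <= t < N) P (w (inord t)) (w (inord t.+1)) * F (fcons (a, w)))).
  rewrite exchange_big /=; apply: eq_bigr => w _.
  rewrite (bigD1 (w (inord 0))) //= [X in _ + X]big1 ?addr0 => [|c cw]; last first.
    by rewrite eq_sym (negbTE cw) !(mul0r, mulr0).
  rewrite !eqxx fcons0 eqxx !mul1r mulrA; congr (_ * _).
  rewrite big_nat_recl // fcons0 fconsS //; congr (_ * _).
  by apply: eq_big_nat => t /andP[_ tN]; rewrite !fconsS // ltnW.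
apply: eq_bigr => c _; rewrite -mulr_sumr IH; congr (_ * _).
apply: path_mean_ext => p sp; congr F; apply/ffunP => i; rewrite !ffunE /=.
case: unliftP => [j ->|->] //=; rewrite ffunE.
by apply: set_nth_default; rewrite /= sp.
Qed.

End Chain.

(** * Symmetric differences and boundaries *)

Definition symdiff (T : finType) (A B : {set T}) : {set T} :=
  (A :\: B) :|: (B :\: A).

Notation "A :+: B" := (symdiff A B) (at level 52, left associativity).

Section SymDiff.
Context (T : finType).
Implicit Types A B C : {set T}.

Lemma in_symdiff A B x : (x \in A :+: B) = (x \in A) (+) (x \in B).
Proof. by rewrite !inE; case: (x \in A); case: (x \in B). Qed.

Lemma symdiffC A B : A :+: B = B :+: A.
Proof. by apply/setP => x; rewrite !in_symdiff addbC. Qed.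

Lemma symdiffA A B C : A :+: (B :+: C) = A :+: B :+: C.
Proof. by apply/setP => x; rewrite !in_symdiff addbA. Qed.

Lemma symdiff0 A : A :+: finset.set0 = A.
Proof. by apply/setP => x; rewrite in_symdiff finset.in_set0 addbF. Qed.

Lemma symdiffK A B : A :+: B :+: B = A.
Proof. by apply/setP => x; rewrite !in_symdiff addbK. Qed.

Lemma symdiffKl A B : A :+: (A :+: B) = B.
Proof. by apply/setP => x; rewrite !in_symdiff addKb. Qed.

Lemma symdiff_inj A : injective (fun B => B :+: A).
Proof. by move=> B C BC; rewrite -(symdiffK B A) BC symdiffK. Qed.

Lemma symdiff_sub A B C : A \subset C -> B \subset C -> A :+: B \subset C.
Proof.
move=> /fintype.subsetP AC /fintype.subsetP BC; apply/fintype.subsetP => x.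
by rewrite in_symdiff => xAB; apply: contraT => xC; move: xAB;
   rewrite (contraNF (AC x)) // (contraNF (BC x)).
Qed.

Lemma odd_symdiff A B : odd #|A :+: B| = odd #|A| (+) odd #|B|.
Proof.
have -> : #|A :+: B| = (#|A :\: B| + #|B :\: A|)%N.
  rewrite cardsU; have -> : (A :\: B) :&: (B :\: A) = finset.set0.
    by apply/setP => x; rewrite !inE; case: (x \in A); case: (x \in B).
  by rewrite cards0 subn0.
rewrite -(cardsID B A) -(cardsID A B) !oddD [B :&: A]finset.setIC.
by case: (odd _); case: (odd _); case: (odd _).
Qed.

End SymDiff.

Section Boundary.
Context (G : sgraph).
Implicit Types (A B : {set {set G}}) (T : {set G}).

Lemma boundary_symdiff A B : boundary (A :+: B) = boundary A :+: boundary B.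
Proof.
apply/setP => v; rewrite in_symdiff !inE -odd_symdiff; congr (odd #|pred_of_set _|).
by apply/setP => f; rewrite !inE; case: (f \in A); case: (f \in B); case: (v \in f).
Qed.

Lemma boundary0 : boundary (finset.set0 : {set {set G}}) = finset.set0.
Proof.
by apply/setP => v; rewrite !inE (_ : [set _ in _ | _] = finset.set0) ?cards0 //;
   apply/setP => f; rewrite !inE.
Qed.

(** An edge is its own boundary. *)
Lemma boundary1 (e : {set G}) : boundary [set e] = e.
Proof.
apply/setP => v; rewrite inE; case ve: (v \in e).
  rewrite (_ : [set _ in _ | _] = [set e]) ?cards1 //.
  by apply/setP => f; rewrite !inE; case: eqP => // ->; rewrite ve.
rewrite (_ : [set _ in _ | _] = finset.set0) ?cards0 //.
by apply/setP => f; rewrite !inE; case: eqP => // ->; rewrite ve.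
Qed.

(** Both C0 and Cuv are of this form, and toggling a fixed edge set maps one
    class onto another. *)
Definition bclass T : {set {set {set G}}} :=
  [set A : {set {set G}} | (A \subset edges G) && (boundary A == T)].

Lemma C0E : C0 G = bclass finset.set0. Proof. by []. Qed.
Lemma CuvE u v : Cuv u v = bclass [set u; v]. Proof. by []. Qed.

Lemma wormsE A : (A \in worms G) =
  (A \subset edges G) && ((#|boundary A| == 0%N) || (#|boundary A| == 2)).
Proof. by rewrite !inE cards_eq0 andb_orr. Qed.

Lemma bclass_symdiff A B T : B \subset edges G ->
  (A :+: B \in bclass (T :+: boundary B)) = (A \in bclass T).
Proof.
move=> BE; rewrite !inE boundary_symdiff (inj_eq (@symdiff_inj _ (boundary B))).
congr (_ && _); apply/idP/idP => AE; last exact: symdiff_sub.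
by rewrite -(symdiffK A B); apply: symdiff_sub.
Qed.

Lemma edgesP (e : {set G}) :
  reflect (exists u v, adj u v /\ e = [set u; v]) (e \in edges G).
Proof.
rewrite inE; apply: (iffP existsP) => [[u /existsP[v /andP[uv /eqP->]]]|[u [v [uv ->]]]].
  by exists u, v.
by exists u; apply/existsP; exists v; rewrite uv eqxx.
Qed.

Lemma adj_neq (u v : G) : adj u v -> u != v.
Proof. by apply: contraTneq => ->; rewrite adj_irrefl. Qed.

Lemma edge_in (u v : G) : adj u v -> [set u; v] \in edges G.
Proof. by move=> uv; apply/edgesP; exists u, v. Qed.

End Boundary.

(** * High-temperature expansion *)

Section HighTemperature.
Context (R : realType) (G : sgraph).
Implicit Types (x beta : R) (T : {set G}) (s : {ffun G -> bool}).

Let sp s T : R := \prod_(v in T) spin R s v.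

Lemma spin_sq s (v : G) : spin R s v * spin R s v = 1.
Proof. by rewrite /spin; case: (s v); rewrite ?mulrNN mulr1. Qed.

Lemma sp_pm1 s T : sp s T = 1 \/ sp s T = -1.
Proof.
rewrite /sp; elim/big_ind: _ => [|a b|v _]; first by left.
  by case=> ->; case=> ->; rewrite ?mulrNN ?mulr1 ?mul1r; auto.
by rewrite /spin; case: (s v); auto.
Qed.

Lemma sp_symdiff s T T' : sp s (T :+: T') = sp s T * sp s T'.
Proof.
rewrite /sp [LHS]big_mkcond [X in X * _]big_mkcond [X in _ * X]big_mkcond -big_split.
apply: eq_bigr => v _ /=; rewrite in_symdiff.
by case: (v \in T); case: (v \in T'); rewrite /= ?mulr1 ?mul1r // spin_sq.
Qed.

Lemma sp_boundary s (A : {set {set G}}) : \prod_(f in A) sp s f = sp s (boundary A).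
Proof.
have [k] := ubnP #|A|; elim: k A => // k IH A Ak.
have [->|[e eA]] := finset.set_0Vmem A.
  by rewrite boundary0 /sp !big1 // => f; rewrite finset.in_set0.
have -> : boundary A = e :+: boundary (A :\ e).
  rewrite -[X in X :+: _](boundary1 e) -boundary_symdiff; congr boundary.
  apply/setP => f; rewrite in_symdiff !inE.
  by case: eqP => [->|_]; rewrite ?eA.
rewrite sp_symdiff -IH; last by move: Ak; rewrite (cardsD1 e A) eA.
by rewrite -[in LHS](finset.setD1K eA) big_setU1 ?finset.setD11.
Qed.

(** Flipping the spin at a vertex of T changes the sign of the product. *)
Lemma sum_sp T : \sum_s sp s T = if T == finset.set0 then 2 ^+ #|G| else 0.
Proof.
transitivity (\sum_(s : {ffun G -> bool})
    \prod_v (if v \in T then if s v then 1 else -1 else 1 : R)).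
  by apply: eq_bigr => s _; rewrite /sp big_mkcond.
rewrite -(bigA_distr_bigA (fun (v : G) b =>
    if v \in T then if b then 1 else -1 else 1 : R)).
case: eqP => [->|/eqP/finset.set0Pn[v vT]].
  rewrite -prodr_const; apply: eq_bigr => v _.
  by rewrite big_bool /= finset.in_set0.
by rewrite (bigD1 v) //= big_bool /= vT subrr mul0r.
Qed.

Lemma prod1D_expand (I : finType) (E : {set I}) (y : I -> R) :
  \prod_(f in E) (1 + y f) = \sum_(A : {set I} | A \subset E) \prod_(f in A) y f.
Proof.
transitivity (\prod_f ((if f \in E then y f else 0) + 1)).
  rewrite big_mkcond; apply: eq_bigr => f _.
  by case: ifP; rewrite ?add0r // addrC.
rewrite bigA_distr [RHS]big_mkcond /=; apply: eq_bigr => A _.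
case: ifPn => [/fintype.subsetP AE|/fintype.subsetPn[f fA fE]].
  rewrite [RHS]big_mkcond; apply: eq_bigr => f _.
  by case: ifP => // /AE ->.
by rewrite (bigD1 f) //= fA (negbTE fE) mul0r.
Qed.

(** Expanding the product over the edges gives one term for each edge set A,
    whose spins multiply to the product over the boundary of A; the sum over
    the spins keeps the sets with boundary T. *)
Lemma high_temperature x T :
  \sum_s sp s T * \prod_(f in edges G) (1 + x * sp s f)
  = 2 ^+ #|G| * lambda x (bclass T).
Proof.
transitivity (\sum_(A : {set {set G}} | A \subset edges G)
    x ^+ #|A| * \sum_s sp s (T :+: boundary A)).
  under eq_bigr do rewrite prod1D_expand mulr_sumr.
  rewrite exchange_big; apply: eq_bigr => A _; rewrite mulr_sumr.
  apply: eq_bigr => s _; rewrite big_split prodr_const /= sp_boundary sp_symdiff.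
  by rewrite mulrCA.
rewrite /lambda mulr_sumr [LHS]big_mkcond [RHS]big_mkcond /=.
apply: eq_bigr => A _; rewrite !inE; case: (A \subset _) => //=.
rewrite sum_sp; have -> : (T :+: boundary A == finset.set0) = (boundary A == T).
  apply/eqP/eqP => [TA|->]; last by apply/setP => v; rewrite in_symdiff addbb inE.
  by rewrite -[LHS](symdiffKl T) TA symdiff0.
by case: eqP => _; rewrite ?mulr0 // mulrC.
Qed.

(** The weights of the expansion are nonnegative and a product of spins is at
    most 1, so the boundary-free class carries the largest total weight. *)
Lemma lambda_bclass_le x T : 0 <= x <= 1 -> lambda x (bclass T) <= lambda x (C0 G).
Proof.
move=> /andP[x0 x1]; rewrite -(@ler_pM2l _ (2 ^+ #|G|)) ?exprn_gt0 //.
rewrite C0E -!high_temperature; apply: ler_sum => s _.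
have w0 : 0 <= \prod_(f in edges G) (1 + x * sp s f).
  by apply: prodr_ge0 => f _; case: (sp_pm1 s f) => ->; lra.
have -> : sp s finset.set0 = 1 by rewrite /sp big1 // => v; rewrite finset.in_set0.
by apply: ler_wpM2r => //; case: (sp_pm1 s T) => -> //; lra.
Qed.

Lemma lambda_gt0 x : 0 < x -> 0 < lambda x (C0 G).
Proof.
move=> x0; rewrite /lambda (bigD1 finset.set0) /=; last first.
  by rewrite !inE finset.sub0set boundary0 eqxx.
rewrite cards0 expr0; apply: ltr_pwDl => //.
by apply: sumr_ge0 => A _; rewrite exprn_ge0 // ltW.
Qed.

Lemma tanh_bounds beta : 0 < beta -> 0 < tanh beta < 1.
Proof.
move=> b0; have := expR_gt0 beta; have := expR_gt0 (- beta) => m p.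
have : expR (- beta) < expR beta by rewrite ltr_expR; lra.
rewrite /tanh => lt; apply/andP; split; first by apply: divr_gt0; lra.
by rewrite ltr_pdivrMr; lra.
Qed.

(** exp (beta s) = cosh beta (1 + s tanh beta) for s = 1 and s = -1. *)
Lemma ising_weightE beta s :
  ising_weight beta s
  = ((expR beta + expR (- beta)) / 2) ^+ #|edges G|
    * \prod_(f in edges G) (1 + tanh beta * sp s f).
Proof.
rewrite /ising_weight mulr_sumr expR_sum -prodr_const -big_split /=.
apply: eq_bigr => f _; rewrite -/(sp s f).
have := expR_gt0 beta; have := expR_gt0 (- beta) => m p.
by rewrite /tanh; case: (sp_pm1 s f) => ->; rewrite ?mulr1 ?mulrN1; field; lra.
Qed.

Lemma two_pointE beta (u v : G) : u != v -> 0 < beta ->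
  two_point beta u v = lambda (tanh beta) (Cuv u v) / lambda (tanh beta) (C0 G).
Proof.
move=> uv b0; have /andP[x0 _] := tanh_bounds b0.
set x := tanh beta in x0 *; set c := ((expR beta + expR (- beta)) / 2) ^+ #|edges G|.
have c0 : 0 < c.
  by rewrite exprn_gt0 // divr_gt0 // addr_gt0 // expR_gt0.
have E T : \sum_s ising_weight beta s * sp s T = c * (2 ^+ #|G| * lambda x (bclass T)).
  rewrite -high_temperature mulr_sumr; apply: eq_bigr => s _.
  by rewrite ising_weightE -mulrA; congr (_ * _); rewrite mulrC.
have Z : \sum_(s : {ffun G -> bool}) ising_weight beta s = c * (2 ^+ #|G| * lambda x (C0 G)).
  rewrite C0E -E; apply: eq_bigr => s _.
  by rewrite /sp big1 ?mulr1 // => w; rewrite finset.in_set0.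
rewrite /two_point /ising_expectation /ising_prob.
transitivity ((\sum_s ising_weight beta s * sp s [set u; v]) / (\sum_(s : {ffun G -> bool}) ising_weight beta s)).
  rewrite mulr_suml; apply: eq_bigr => s _.
  by rewrite mulrAC /sp big_setU1 ?big_set1 // inE.
have l0 := lambda_gt0 x0.
by rewrite E Z CuvE; field; rewrite !gt_eqF // exprn_gt0.
Qed.

Lemma two_point_diag beta (u : G) : two_point beta u u = 1.
Proof.
rewrite /two_point /ising_expectation /ising_prob.
under eq_bigr do rewrite spin_sq mulr1.
rewrite -mulr_suml divff // gt_eqF // (bigD1 [ffun=> true]) //=.
rewrite ltr_pwDl ?expR_gt0 //; apply: sumr_ge0 => s _; exact: expR_ge0.
Qed.

Lemma lambda_shift x T (M : {set {set G}}) : M \subset edges G ->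
  \sum_(A in bclass T) x ^+ #|A :+: M| = lambda x (bclass (T :+: boundary M)).
Proof.
move=> ME; rewrite /lambda [RHS](reindex_inj (@symdiff_inj _ M)) /=.
by apply: eq_bigl => A; rewrite bclass_symdiff.
Qed.

Lemma lambda_edge x T (u w : G) : 0 < x < 1 -> adj u w ->
  x * lambda x (bclass T) <= lambda x (bclass (T :+: [set u; w])).
Proof.
move=> /andP[x0 x1] uw; rewrite -(boundary1 [set u; w]) -lambda_shift; last first.
  by rewrite finset.sub1set edge_in.
rewrite mulr_sumr; apply: ler_sum => A _; rewrite -exprS.
rewrite ler_iXn2l ?(ltW x0) ?(ltW x1) //.
apply: (@leq_trans #|[set u; w] |: A|); last by rewrite cardsU1; case: (_ \in _).
apply: subset_leq_card; apply/fintype.subsetP => f; rewrite in_symdiff !inE.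
by case: (f == _); case: (f \in A).
Qed.

(** Each edge of the walk moves the boundary by one step and costs at most a
    factor x. *)
Lemma lambda_walk x (u : G) (p : seq G) : 0 < x < 1 -> path (@adj G) u p ->
  u != last u p ->
  x ^+ size p * lambda x (C0 G) <= lambda x (Cuv u (last u p)).
Proof.
move=> x01 up ul.
suff H T : x ^+ size p * lambda x (bclass T)
    <= lambda x (bclass (T :+: ([set u] :+: [set last u p]))).
  rewrite C0E CuvE; apply: le_trans (H _) _; rewrite le_eqVlt; apply/orP; left.
  apply/eqP; congr (lambda x (bclass _)); apply/setP => v.
  rewrite !in_symdiff !inE /=; by case: (eqVneq v u) => [->|_] //=; rewrite (negbTE ul).
elim: p u up T {ul} => [|w p IH] u /= up T.
  by rewrite mul1r symdiffA symdiffK.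
case/andP: up => uw wp; rewrite exprSr -mulrA.
have /andP[x0 _] := x01.
apply: le_trans (ler_wpM2l _ (lambda_edge T x01 uw)) _; first by rewrite exprn_ge0 ?ltW.
apply: le_trans (IH _ wp _) _; rewrite le_eqVlt; apply/orP; left.
apply/eqP; congr (lambda x (bclass _)); apply/setP => v.
have := adj_neq uw; rewrite !in_symdiff !inE => nuw.
case: (eqVneq v u) => [->|_].
  by rewrite (negbTE nuw); case: (u \in T); case: (u == last w p).
by case: (v \in T); case: (v == w); case: (v == last w p).
Qed.

(** Shortening a path to one without repetitions makes it shorter than the
    number of vertices, so that the search defining the distance succeeds. *)
Lemma gdist_walk (u v : G) : connected_graph G -> exists2 p : seq G,
  path (@adj G) u p & last u p = v /\ size p = gdist u v.
Proof.
move=> /(_ u v)/connectP[p0 up0 ->].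
case/shortenP: up0 => p up un _.
set b := fun l => [exists q : l.-tuple G, path (@adj G) u q && (last u q == last u p)].
have hb : has b (iota 0 #|G|).
  apply/hasP; exists (size p).
    rewrite mem_iota /= add0n; have := max_card (mem (u :: p)).
    by rewrite (card_uniqP un).
  by apply/existsP; exists (in_tuple p); rewrite up eqxx.
have lt : (gdist u (last u p) < #|G|)%N.
  by move: hb; rewrite has_find size_iota.
have := nth_find 0%N hb; rewrite -/(gdist u (last u p)) nth_iota // add0n.
by case/existsP => q /andP[uq /eqP lq]; exists q; rewrite ?size_tuple.
Qed.

Lemma lambda_Cuv_ge x (u v : G) k : 0 < x < 1 -> connected_graph G ->
  u != v -> (gdist u v <= k)%N -> x ^+ k * lambda x (C0 G) <= lambda x (Cuv u v).
Proof.
move=> x01 Gc uv dk; have [p up [lv sp']] := gdist_walk u v Gc.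
move: (x01) => /andP[x0 x1].
apply: le_trans (_ : x ^+ size p * lambda x (C0 G) <= _).
  by rewrite ler_wpM2r ?(ltW (lambda_gt0 x0)) // sp' ler_wiXn2l // ltW.
by have := @lambda_walk x u p x01 up; rewrite lv => /(_ uv).
Qed.

End HighTemperature.

(** * The worm kernel *)

Section WormKernel.
Context (R : realType) (G : sgraph) (x : R).
Hypothesis x01 : 0 < x < 1.
Implicit Types (A B : worm G) (u v : G).

Let x_gt0 : 0 < x. Proof. by case/andP: x01. Qed.
Let x_le1 : x <= 1. Proof. by case/andP: x01 => _ /ltW. Qed.

Lemma worm_C2 A : (val A \in C2 G) = (val A \notin C0 G).
Proof.
have := valP A; rewrite wormsE !inE -cards_eq0 => /andP[-> ].
by rewrite /=; case/orP => /eqP ->.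
Qed.

Lemma card_boundary A : val A \notin C0 G -> #|boundary (val A)| = 2.
Proof. by rewrite -worm_C2 inE => /andP[_ /eqP]. Qed.

Lemma boundary_C0 A : val A \in C0 G -> boundary (val A) = finset.set0.
Proof. by rewrite inE => /andP[_ /eqP]. Qed.

Lemma degree_gt0 u v : adj u v -> (0 < (degree u)%:R :> R).
Proof.
by move=> uv; rewrite ltr0n; apply/card_gt0P; exists v; rewrite inE.
Qed.

Lemma degree_le u : ((degree u)%:R <= (max_degree G)%:R :> R).
Proof. by rewrite ler_nat; apply: (leq_bigmax (F := @degree G)). Qed.

(** This allows both orientations of the toggled edge; between two open worms
    only the one that starts in the boundary of A is a worm move. *)
Definition moved A B u v :=
  adj u v && (val B == val A :+: [set [set u; v]]).

Lemma moveE A B u v : worm_move A B (u, v) = moved A B u v &&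
  (((val A \notin C0 G) && (val B \notin C0 G)) ==> (u \in boundary (val A))).
Proof. by rewrite /worm_move !worm_C2 andbA. Qed.

Lemma moved_sym A B u v : moved A B u v -> moved B A v u.
Proof.
case/andP=> uv /eqP BA; rewrite /moved adj_sym uv BA /=.
by rewrite [in [set v; u]]finset.setUC symdiffK.
Qed.

Lemma moved_swap A B u v : moved A B u v = moved A B v u.
Proof. by rewrite /moved adj_sym finset.setUC. Qed.

Lemma moved_neq A B u v : moved A B u v -> A != B.
Proof.
move=> /andP[_ /eqP BA]; apply: contraTneq isT => AB.
move: BA; rewrite -AB => /setP/(_ [set u; v]).
by rewrite in_symdiff finset.set11; case: (_ \in _).
Qed.

Lemma moved_boundary A B u v : moved A B u v ->
  boundary (val B) = boundary (val A) :+: [set u; v].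
Proof. by case/andP=> _ /eqP ->; rewrite boundary_symdiff boundary1. Qed.

(** Between two open worms one endpoint of the toggled edge leaves the
    boundary and the other one enters it. *)
Lemma moved_C2 A B u v : moved A B u v -> val A \notin C0 G -> val B \notin C0 G ->
  (v \in boundary (val A)) = (u \notin boundary (val A)).
Proof.
move=> m A2 B2; have bB := moved_boundary m.
have uv : u != v by case/andP: m => /adj_neq.
have sub (S T : {set G}) : #|S| = 2 -> #|T| = 2 -> u \in S -> v \in S ->
    u \notin T -> v \notin T -> T = S :+: [set u; v] -> False.
  move=> S2 T2 uS vS uT vT TE.
  have SE : [set u; v] = S.
    apply/eqP; rewrite eqEcard S2 cards2 uv andbT.
    by apply/fintype.subsetP => w; rewrite !inE => /orP[]/eqP->.
  move: T2; rewrite TE -SE (_ : _ :+: _ = finset.set0) ?cards0 //.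
  by apply/setP => w; rewrite in_symdiff addbb inE.
have uB : (u \in boundary (val B)) = (u \notin boundary (val A)).
  by rewrite bB in_symdiff finset.set21 addbT.
have vB : (v \in boundary (val B)) = (v \notin boundary (val A)).
  by rewrite bB in_symdiff finset.set22 addbT.
have cA := card_boundary A2; have cB := card_boundary B2.
case uA: (u \in _); case vA: (v \in _) => //=; exfalso.
  by apply: (sub _ _ cA cB uA vA) => //; rewrite ?uB ?vB ?uA ?vA.
apply: (sub _ _ cB cA); rewrite ?uB ?vB ?uA ?vA //.
by rewrite bB symdiffK.
Qed.

Lemma move_sym A B u v : worm_move A B (u, v) -> worm_move B A (v, u).
Proof.
rewrite !moveE => /andP[m H]; rewrite (moved_sym m) /=.
apply/implyP => /andP[B2 A2]; move: H; rewrite A2 B2 /= => uA.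
by rewrite (moved_boundary m) in_symdiff finset.set22 addbT (moved_C2 m) ?negbK.
Qed.

Lemma move_exists A B u v : moved A B u v ->
  worm_move A B (u, v) \/ worm_move A B (v, u).
Proof.
move=> m; rewrite !moveE m -moved_swap m /=.
case A2: (val A \notin C0 G) => /=; last by left.
case B2: (val B \notin C0 G) => /=; last by left.
by rewrite (moved_C2 m) //; case: (u \in _); auto.
Qed.

Lemma rate_swap A B u v : (val A \in C0 G) || (val B \in C0 G) ->
  worm_rate x A B u v = worm_rate x A B v u.
Proof.
rewrite /worm_rate [[set v; u]]finset.setUC.
by case: (val A \in _) => /= [_|->]; rewrite [1 / _ + _]addrC.
Qed.

Lemma moved_unique A B u v u' v' : moved A B u v -> moved A B u' v' ->
  (u', v') = (u, v) \/ (u', v') = (v, u).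
Proof.
move=> /andP[uv /eqP BA] /andP[uv' /eqP]; rewrite BA => E.
have : [set [set u; v]] = [set [set u'; v']].
  by rewrite -(symdiffKl (val A) [set [set u; v]]) E symdiffKl.
move/finset.set1_inj/setP => H; have := H u'; have := H v'.
have := adj_neq uv'; rewrite !inE !eqxx orbT.
by move=> n /orP[]/eqP v'E /orP[]/eqP u'E; subst; rewrite ?eqxx in n *; auto.
Qed.

(** The orientation that the kernel picks does not affect the rate. *)
Lemma offdiagE A B u v : worm_move A B (u, v) ->
  worm_offdiag x A B = worm_rate x A B u v.
Proof.
move=> m; rewrite /worm_offdiag; case: pickP => [[u' v'] m'|/(_ (u, v))]; last by rewrite m.
move: m m'; rewrite /= !moveE => /andP[m i] /andP[m' i'].
case: (moved_unique m m') => -[E1 E2]; subst; first by [].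
case H: ((val A \in C0 G) || (val B \in C0 G)); first by rewrite rate_swap.
move/negbT: H; rewrite negb_or => /andP[A2 B2].
by move: i i'; rewrite A2 B2 /= (moved_C2 m) // => ->.
Qed.

(** The Prokof'ev-Svistunov weight without its normalization. *)
Definition worm_weight A : R := x ^+ #|val A| * psi R A.

Lemma worm_weight_gt0 A : (0 < #|G|)%N -> 0 < worm_weight A.
Proof.
by move=> n0; rewrite mulr_gt0 ?exprn_gt0 // /psi; case: ifP; rewrite ?ltr0n.
Qed.

Lemma card_moved A B u v : moved A B u v ->
  let e := [set u; v] in
  [/\ (#|val A| + (e \notin val A))%N = #|e |: val A|,
      (#|val B| + (e \notin val B))%N = #|e |: val A|
    & (e \in val B) = (e \notin val A)].
Proof.
move=> /andP[_ /eqP BA] e.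
have eB : (e \in val B) = (e \notin val A) by rewrite BA in_symdiff finset.set11 addbT.
split=> //; first by rewrite cardsU1 addnC.
rewrite addnC -cardsU1; apply: eq_card => f; rewrite BA in_setU1 in_symdiff.
by rewrite !inE; case: (f == e); case: (f \in val A).
Qed.

Lemma weight_rate_C0 A B u v : moved A B u v ->
  (val A \in C0 G) || (val B \in C0 G) ->
  worm_weight A * worm_rate x A B u v
  = x ^+ #|[set u; v] |: val A| / 2 * ((degree u)%:R^-1 + (degree v)%:R^-1).
Proof.
move=> m H; have [cA _ _] := card_moved m; rewrite -cA exprD /worm_weight /worm_rate /psi.
have n0 : (#|G|%:R : R) != 0 by rewrite pnatr_eq0 -lt0n; apply/card_gt0P; exists u.
case/andP: (m) => uv _; have du := degree_gt0 uv.
have dv : 0 < (degree v)%:R :> R by rewrite (@degree_gt0 _ u) // adj_sym.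
move: (x ^+ _) (x ^+ _) => y t.
case: ifP H => [_ _|_ /= ->]; first by field; rewrite n0 !gt_eqF.
by field; rewrite !gt_eqF.
Qed.

(** The minimum in the rate is the one of a Metropolis chain, which makes the
    flow symmetric in the two worms. *)
Lemma weight_rate_C2 A B u v : moved A B u v ->
  val A \notin C0 G -> val B \notin C0 G ->
  worm_weight A * worm_rate x A B u v
  = Num.min (x ^+ #|val A| / (degree u)%:R) (x ^+ #|val B| / (degree v)%:R) / 2.
Proof.
move=> m A2 B2; have [cA cB eB] := card_moved m.
case/andP: (m) => uv _; have du := degree_gt0 uv.
have dv : 0 < (degree v)%:R :> R by rewrite (@degree_gt0 _ u) // adj_sym.
have -> : x ^+ #|val B| = x ^+ #|val A|
    * (x ^+ ([set u; v] \notin val A) / x ^+ ([set u; v] \in val A)).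
  rewrite mulrA -exprD cA -cB eB negbK exprD mulfK //.
  by rewrite expf_neq0 // gt_eqF.
rewrite /worm_weight /worm_rate /psi (negbTE A2) (negbTE B2).
set t := _ / x ^+ _; set y := x ^+ _.
have y0 : 0 < y by rewrite exprn_gt0.
have t0 : 0 < t by rewrite divr_gt0 // exprn_gt0.
have c0 : 0 < y / (degree u)%:R by rewrite divr_gt0.
rewrite -[in RHS](mulr1 (y / (degree u)%:R)).
have -> : y * t / (degree v)%:R
    = y / (degree u)%:R * ((degree u)%:R / (degree v)%:R * t).
  by field; rewrite !gt_eqF.
rewrite -minr_pMr ?(ltW c0) // minC; move: (Num.min _ _) => w.
by field; rewrite !gt_eqF.
Qed.

Lemma moved_flow_sym A B u v : worm_move A B (u, v) ->
  worm_weight A * worm_rate x A B u v = worm_weight B * worm_rate x B A v u.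
Proof.
rewrite moveE => /andP[m _]; have m' := moved_sym m.
case H: ((val A \in C0 G) || (val B \in C0 G)).
  rewrite !weight_rate_C0 //; last by rewrite orbC.
  have [_ cB eB] := card_moved m; have [cB' _ _] := card_moved m'.
  by rewrite -cB' -cB [[set v; u]]finset.setUC [_^-1 + _]addrC.
move/negbT: H; rewrite negb_or => /andP[A2 B2].
by rewrite !weight_rate_C2 // minC.
Qed.

Lemma worm_balance A B :
  worm_weight A * worm_offdiag x A B = worm_weight B * worm_offdiag x B A.
Proof.
case mAB: [exists p, worm_move A B p].
  case/existsP: mAB => -[u v] m.
  by rewrite (offdiagE m) (offdiagE (move_sym m)) moved_flow_sym.
rewrite /worm_offdiag; case: pickP => [p m|_].
  by move/existsP: mAB; case; exists p.
case: pickP => [[u v] m|_]; last by rewrite !mulr0.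
by move/existsP: mAB; case; exists (v, u); apply: move_sym.
Qed.

(** Lower bound on the stationary flow through the edge toggled between A and
    B: it is the weight of the larger edge set, up to twice the maximum degree. *)
Lemma worm_flow_ge A B u v : moved A B u v ->
  x ^+ #|[set u; v] |: val A|
    <= 2 * (max_degree G)%:R * (worm_weight A * worm_offdiag x A B).
Proof.
move=> m0.
suff H u' v' : worm_move A B (u', v') -> [set u'; v'] = [set u; v] ->
   x ^+ #|[set u; v] |: val A|
    <= 2 * (max_degree G)%:R * (worm_weight A * worm_rate x A B u' v').
  case: (move_exists m0) => m; rewrite (offdiagE m); apply: H => //.
  by rewrite finset.setUC.
rewrite moveE => /andP[m _] E; rewrite -E {u v E m0}; move: m.
move: u' v' => u v m; case/andP: (m) => uv _; have du := degree_gt0 uv.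
have dv : 0 < (degree v)%:R :> R by rewrite (@degree_gt0 _ u) // adj_sym.
have uD := degree_le u; have vD := degree_le v.
have D0 := lt_le_trans du uD.
set y := x ^+ _; have y0 : 0 < y by rewrite exprn_gt0.
have bound d z : 0 < d -> d <= (max_degree G)%:R -> y <= z ->
    y <= (max_degree G)%:R * (z / d) :> R.
  move=> d0 dD yz; rewrite mulrCA; apply: (le_trans yz).
  by apply: ler_peMr; [exact: le_trans (ltW y0) yz|rewrite ler_pdivlMr ?mul1r].
case H: ((val A \in C0 G) || (val B \in C0 G)).
  rewrite weight_rate_C0 // -/y.
  have := bound _ _ du uD (lexx y); have := bound _ _ dv vD (lexx y).
  move: (_^-1) (_^-1) => iv iu.
  by rewrite [_ * (_ / 2 * _)](_ : _ = (max_degree G)%:R * (y * iu)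
     + (max_degree G)%:R * (y * iv)); [lra | field].
move/negbT: H; rewrite negb_or => /andP[A2 B2].
rewrite weight_rate_C2 //; have [cA cB _] := card_moved m.
have yA : y <= x ^+ #|val A| by rewrite /y -cA ler_wiXn2l ?(ltW x_gt0) ?leq_addr.
have yB : y <= x ^+ #|val B| by rewrite /y -cB ler_wiXn2l ?(ltW x_gt0) ?leq_addr.
have bA := bound _ _ du uD yA; have bB := bound _ _ dv vD yB.
rewrite [leRHS](_ : _ = (max_degree G)%:R *
   Num.min (x ^+ #|val A| / (degree u)%:R) (x ^+ #|val B| / (degree v)%:R)).
  by rewrite minElt; case: ifP.
by move: (Num.min _ _) => w; field.
Qed.

(** The share of one endpoint in the rate of an edge; the shares of all the
    edges at u sum to 1/(2n) in a closed worm, and to 1/4 at either boundary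
    vertex of an open one. *)
Definition endpoint_rate A u : R :=
  if val A \in C0 G then (2 * #|G|%:R * (degree u)%:R)^-1
  else if u \in boundary (val A) then (4 * (degree u)%:R)^-1 else 0.

Lemma endpoint_rate_ge0 A u : 0 <= endpoint_rate A u.
Proof.
by rewrite /endpoint_rate; do 2?case: ifP; rewrite // => *; rewrite invr_ge0 !mulr_ge0.
Qed.

Lemma rate_le_endpoints A B u v : worm_move A B (u, v) ->
  worm_rate x A B u v <=
   if (val A \in C0 G) || (val B \in C0 G) then endpoint_rate A u + endpoint_rate A v
   else endpoint_rate A u.
Proof.
rewrite moveE => /andP[m i]; case/andP: (m) => uv _; have du := degree_gt0 uv.
have dv : 0 < (degree v)%:R :> R by rewrite (@degree_gt0 _ u) // adj_sym.
have n0 : 0 < (#|G|%:R : R) by rewrite ltr0n; apply/card_gt0P; exists u.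
have xe k : x ^+ k <= 1 by rewrite exprn_ile1 ?(ltW x_gt0).
rewrite /worm_rate /endpoint_rate.
case: ifP i => [A0 _|/negbT A2] /=.
  have -> : (2 * #|G|%:R * (degree u)%:R)^-1 + (2 * #|G|%:R * (degree v)%:R)^-1
    = 1 / (2 * #|G|%:R) * (1 / (degree u)%:R + 1 / (degree v)%:R) :> R.
    by field; rewrite !gt_eqF.
  by rewrite -mulrA ler_piMl // mulr_ge0 ?addr_ge0 ?divr_ge0 ?mulr_ge0 // ltW.
case: ifP => [B0 _|/negbT B2 /= uA].
  have -> : boundary (val A) = [set u; v].
    by rewrite -[LHS](symdiffK _ [set u; v]) -(moved_boundary m) boundary_C0 //
       symdiffC symdiff0.
  rewrite finset.set21 finset.set22.
  have -> : (4 * (degree u)%:R)^-1 + (4 * (degree v)%:R)^-1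
    = 1 / 4 * (1 / (degree u)%:R + 1 / (degree v)%:R) :> R.
    by field; rewrite !gt_eqF.
  by rewrite -mulrA ler_piMl // mulr_ge0 ?addr_ge0 ?divr_ge0 // ltW.
rewrite uA div1r ler_piMl ?invr_ge0 ?mulr_ge0 ?(ltW du) //.
by rewrite ge_min lexx orbT.
Qed.

(** Each oriented edge is charged with the rate of its first endpoint. *)
Lemma offdiag_le_endpoints A B : worm_offdiag x A B <=
  \sum_(p : G * G | moved A B p.1 p.2) endpoint_rate A p.1.
Proof.
have S0 (Q : pred (G * G)) : 0 <= \sum_(p | Q p) endpoint_rate A p.1.
  by apply: sumr_ge0 => *; apply: endpoint_rate_ge0.
rewrite /worm_offdiag; case: pickP => [[u v] m|_]; last exact: S0.
apply: le_trans (rate_le_endpoints m) _.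
have m1 : moved A B u v by move: m; rewrite moveE => /andP[].
have uv : u != v by case/andP: m1 => /adj_neq.
rewrite (bigD1 (u, v)) //=; case: ifP => _; last by rewrite lerDl S0.
rewrite lerD2l (bigD1 (v, u)) /= ?lerDl ?S0 //.
by rewrite -moved_swap m1 xpair_eqE negb_and eq_sym uv.
Qed.

Lemma offdiag_row_le A : (0 < #|G|)%N ->
  \sum_(B | B != A) worm_offdiag x A B <= 2^-1.
Proof.
move=> n0; have n0R : 0 < (#|G|%:R : R) by rewrite ltr0n.
apply: (@le_trans _ _ (\sum_(p : G * G | adj p.1 p.2) endpoint_rate A p.1)).
  apply: (@le_trans _ _ (\sum_B \sum_(p : G * G | moved A B p.1 p.2) endpoint_rate A p.1)).
    rewrite [leRHS](bigD1 A) //= ler_wpDl //.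
      by apply: sumr_ge0 => *; apply: endpoint_rate_ge0.
    by apply: ler_sum => B _; apply: offdiag_le_endpoints.
  rewrite (exchange_big_dep (fun p : G * G => adj p.1 p.2)) /=; last first.
    by move=> B p _ /andP[].
  apply: ler_sum => -[u v] /= uv.
  case: (pickP (fun B => moved A B u v)) => [B m|none]; last first.
    by rewrite big_pred0 ?endpoint_rate_ge0.
  rewrite (big_pred1 B) // => B' /=; apply/idP/eqP => [m'|-> //].
  by apply: val_inj; case/andP: m => _ /eqP->; case/andP: m' => _ /eqP->.
rewrite -(pair_big_dep xpredT (fun u v : G => adj u v) (fun u _ => endpoint_rate A u)) /=.
have E u : \sum_(v | adj u v) endpoint_rate A u <=
    if val A \in C0 G then (2 * #|G|%:R)^-1
    else if u \in boundary (val A) then 4^-1 else 0.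
  rewrite sumr_const -[endpoint_rate _ _ *+ _]mulr_natr.
  have -> : #|(fun v => adj u v)| = degree u.
    by rewrite /degree cardsE.
  have [d0|d0] := posnP (degree u).
    rewrite d0 mulr0; do 2?case: ifP => //; by rewrite ?invr_ge0 ?mulr_ge0 ?(ltW n0R).
  have d0R : (degree u)%:R != 0 :> R by rewrite pnatr_eq0 -lt0n.
  rewrite /endpoint_rate; case: ifP => _; first by rewrite invfM mulfVK.
  by case: ifP => _; rewrite ?mul0r // invfM mulfVK.
apply: le_trans (ler_sum _ (fun u _ => E u)) _.
case A0: (val A \in C0 G); last move/negbT: A0 => A2.
  rewrite sumr_const -[_ *+ _]mulr_natr.
  have -> : #|(fun _ : G => true)| = #|G| by apply: eq_card.
  by rewrite invfM mulfVK // gt_eqF.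
have -> : \sum_u (if u \in boundary (val A) then 4^-1 else 0)
    = \sum_(u in boundary (val A)) 4^-1 :> R by rewrite [RHS]big_mkcond.
rewrite sumr_const card_boundary // -[_ *+ _]mulr_natr.
by rewrite le_eqVlt; apply/orP; left; apply/eqP; field.
Qed.

Lemma worm_rate_ge0 A B u v : 0 <= worm_rate x A B u v.
Proof.
have xe k : 0 <= x ^+ k by rewrite exprn_ge0 // ltW.
rewrite /worm_rate; do 2?case: ifP => _; rewrite ?mulr_ge0 ?addr_ge0 ?divr_ge0 ?mulr_ge0 //.
by rewrite le_min ler01 mulr_ge0 // divr_ge0.
Qed.

Lemma worm_offdiag_ge0 A B : 0 <= worm_offdiag x A B.
Proof. by rewrite /worm_offdiag; case: pickP => // p _; apply: worm_rate_ge0. Qed.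

Lemma worm_matrix_sum A : \sum_B worm_matrix x A B = 1.
Proof.
rewrite (bigD1 A) //= {1}/worm_matrix eqxx.
rewrite [X in _ + X](eq_bigr (worm_offdiag x A)) ?subrK // => B BA.
by rewrite /worm_matrix eq_sym (negbTE BA).
Qed.

Lemma worm_matrix_lazy A : (0 < #|G|)%N -> 2^-1 <= worm_matrix x A A.
Proof.
by move=> n0; rewrite /worm_matrix eqxx; have := offdiag_row_le A n0; lra.
Qed.

Lemma worm_matrix_ge0 A B : (0 < #|G|)%N -> 0 <= worm_matrix x A B.
Proof.
move=> n0; have [<-|AB] := eqVneq A B.
  by have := worm_matrix_lazy A n0; lra.
by rewrite /worm_matrix (negbTE AB) worm_offdiag_ge0.
Qed.

Lemma worm_matrix_balance A B :
  worm_weight A * worm_matrix x A B = worm_weight B * worm_matrix x B A.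
Proof.
have [->//|AB] := eqVneq A B.
by rewrite /worm_matrix (negbTE AB) eq_sym (negbTE AB) worm_balance.
Qed.

End WormKernel.

(** * Canonical paths *)

Section Unwinding.
Context (G : sgraph).
Implicit Types (D A F S : {set {set G}}) (e : {set G}).

Lemma sub_symdiff F D : F \subset edges G ->
  (D :+: F \subset edges G) = (D \subset edges G).
Proof.
move=> FE; apply/idP/idP => DE; last exact: symdiff_sub.
by rewrite -(symdiffK D F); apply: symdiff_sub.
Qed.

Lemma worms_symdiff F D : F \in C0 G -> (D :+: F \in worms G) = (D \in worms G).
Proof.
rewrite [F \in _]inE => /andP[FE /eqP F0].
by rewrite !wormsE boundary_symdiff F0 symdiff0 sub_symdiff.
Qed.

Lemma C0_symdiff F D : F \in C0 G -> (D :+: F \in C0 G) = (D \in C0 G).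
Proof.
rewrite [F \in _]inE => /andP[FE /eqP F0].
by rewrite [LHS]inE [RHS]inE boundary_symdiff F0 symdiff0 sub_symdiff.
Qed.

(** In a closed worm every edge can go; in an open one, any edge at an
    endpoint: the endpoint moves along that edge. *)
Lemma removable_edge D : D \in worms G -> D != finset.set0 ->
  exists2 e, e \in D & D :+: [set e] \in worms G.
Proof.
rewrite wormsE => /andP[DE bD] D0.
have sub e : e \in D -> D :+: [set e] \subset edges G.
  by move=> eD; rewrite symdiff_sub // finset.sub1set (fintype.subsetP DE).
case/orP: bD => [|/eqP b2].
  rewrite cards_eq0 => /eqP b0; have [e eD] := finset.set0Pn _ D0.
  exists e => //; rewrite wormsE sub //= boundary_symdiff b0 boundary1 symdiffC symdiff0.
  by have /edgesP[u [v [uv ->]]] := fintype.subsetP DE _ eD; rewrite cards2 (adj_neq uv) orbT.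
have [u uD] : exists u, u \in boundary D by apply/card_gt0P; rewrite b2.
have [e] : exists e, e \in [set f in D | u \in f].
  by apply/card_gt0P/odd_gt0; rewrite inE in uD.
rewrite inE => /andP[eD ue]; exists e => //.
have /edgesP[v [w [vw eE]]] := fintype.subsetP DE _ eD.
rewrite wormsE sub //= boundary_symdiff boundary1.
have e2 : #|e| = 2 by rewrite eE cards2 (adj_neq vw).
have odd2 : odd #|boundary D :+: e| = false by rewrite odd_symdiff b2 e2.
suff : (#|boundary D :+: e| <= 2)%N.
  by case: #|_| odd2 => [|[|[|]]].
(* both sets of size 2 contain u, which cancels *)
have : boundary D :+: e \subset (boundary D :\ u) :|: (e :\ u).
  apply/fintype.subsetP => z; rewrite in_symdiff finset.in_setU !finset.in_setD1.
  by case: eqP => [->|_] /=; [rewrite uD ue|case: (z \in boundary D)].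
move/subset_leq_card/leq_trans; apply; apply: leq_trans (leq_card_setU _ _) _.
have := cardsD1 u (boundary D); have := cardsD1 u e.
by rewrite uD ue b2 e2 !add1n => -[<-] [<-].
Qed.

(** Removing the edges of D one by one so that every remainder is a worm: S e
    is the remainder just before e goes, and any function of the remainder
    telescopes along the way. *)
Lemma unwinding D : D \in worms G -> exists S : {set G} -> {set {set G}},
  (forall e, e \in D ->
     [/\ e \in S e, S e \subset D, S e \in worms G & S e :+: [set e] \in worms G]) /\
  (forall (V : zmodType) (g : {set {set G}} -> V),
     g D - g finset.set0 = \sum_(e in D) (g (S e) - g (S e :+: [set e]))).
Proof.
have [k] := ubnP #|D|; elim: k D => // k IH D Dk DW.
have [D0|D0] := eqVneq D finset.set0.
  by exists (fun=> D); split=> [e|V g]; rewrite D0 ?inE // subrr big_set0.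
have [e0 e0D D'W] := removable_edge DW D0; set D' := D :+: [set e0] in D'W.
have D'E : D' = D :\ e0.
  by apply/setP => f; rewrite in_symdiff !inE; case: eqP => [->|_] /=; rewrite ?e0D ?addbF.
have D'k : (#|D'| < k)%N by move: Dk; rewrite (cardsD1 e0) e0D D'E.
have [S [SP ST]] := IH _ D'k D'W.
exists (fun e => if e == e0 then D else S e); split=> [e eD|V g].
  case: eqP => [->|/eqP ne]; first by split.
  have eD' : e \in D' by rewrite D'E !inE ne.
  have [? SD ? ?] := SP e eD'; split=> //.
  by apply: fintype.subset_trans SD _; rewrite D'E subD1set.
rewrite (big_setD1 e0) //= eqxx -D'E -[LHS](subrKA (g D')) -/D' ST.
by congr (_ + _); apply: eq_bigr => e; rewrite D'E !inE => /andP[/negbTE->].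
Qed.

(** The exchange of weights behind the injection of Jerrum and Sinclair: an
    edge of D is counted once on either side, any other edge twice or not at
    all. *)
Lemma exchange_card D F S e : S \subset D -> e \in S ->
  (#|F| + #|D :+: F| = #|e |: (F :+: S)| + #|D :+: (e |: (F :+: S))|)%N.
Proof.
move=> /fintype.subsetP SD eS; have cE (A : {set {set G}}) : #|A| = (\sum_f (f \in A))%N.
  by rewrite -sum1_card big_mkcond; apply: eq_bigr => f _; case: (f \in A).
rewrite !cE -!big_split; apply: eq_bigr => f _ /=.
rewrite !in_symdiff finset.in_setU1 in_symdiff; case: eqP => [->|_] /=.
  by rewrite (SD _ eS); case: (e \in F).
by move: (SD f); case: (f \in S) => [->//|_]; case: (f \in D); case: (f \in F).
Qed.

End Unwinding.

(** * The Poincare inequality of the worm process *)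

Section Poincare.
Context (R : realType) (G : sgraph) (x : R).
Hypothesis x01 : 0 < x < 1.
Implicit Types (a b : worm G) (A D F : {set {set G}}) (e : {set G}).

Let n : R := #|G|%:R.
Let m : R := #|edges G|%:R.
Let Dmax : R := (max_degree G)%:R.
Let x_gt0 : 0 < x. Proof. by case/andP: x01. Qed.
Let x0 : 0 <= x. Proof. exact: ltW. Qed.
Let x_le1 : x <= 1. Proof. by case/andP: x01 => _ /ltW. Qed.

(** The factor psi on edge sets, for sums that are reindexed by a symmetric
    difference and hence leave the type of worms. *)
Definition set_psi A : R := if A \in C0 G then n else 2.

Lemma sum_worms (h : {set {set G}} -> R) :
  \sum_(a : worm G) psi R a * h (val a) = n * \sum_(A in C0 G) h A + 2 * \sum_(A in C2 G) h A.
Proof.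
rewrite -(big_sub (mem (worms G)) (fun A => set_psi A * h A)) /=.
rewrite (big_setID (C0 G)) /= !mulr_sumr; congr (_ + _).
  rewrite (_ : worms G :&: C0 G = C0 G); last first.
    by apply/setP => A; rewrite !inE; case: (A \subset _); case: (_ == finset.set0); rewrite ?andbF.
  by apply: eq_bigr => A A0; rewrite /set_psi A0.
rewrite (_ : worms G :\: C0 G = C2 G); last first.
  apply/setP => A; rewrite !inE -cards_eq0; case: (A \subset _) => //=.
  by case: #|_| => [|[|[|k]]].
apply: eq_bigr => A A2; rewrite /set_psi; case: ifP => // A0.
by move: A0 A2; rewrite !inE => /andP[_ /eqP ->]; rewrite cards0 andbF.
Qed.

(** There are n(n-1)/2 boundaries of size 2, each of which contributes at most
    as much as the empty one. *)
Lemma sum_psi_shift A : A \subset edges G ->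
  \sum_(a : worm G) psi R a * x ^+ #|val a :+: A| <= n ^+ 2 * lambda x (C0 G).
Proof.
move=> AE; rewrite (sum_worms (fun B => x ^+ #|B :+: A|)).
have b T : \sum_(B in bclass T) x ^+ #|B :+: A| <= lambda x (C0 G).
  by rewrite lambda_shift // lambda_bclass_le // x0 x_le1.
have b2 : \sum_(B in C2 G) x ^+ #|B :+: A|
    <= \sum_(T : {set G} | #|T| == 2) lambda x (C0 G).
  rewrite (partition_big (@boundary G) (fun T : {set G} => #|T| == 2)) /=; last first.
    by move=> B; rewrite inE => /andP[].
  apply: ler_sum => T /eqP T2; apply: le_trans (b T); rewrite le_eqVlt.
  apply/orP; left; apply/eqP/eq_bigl => B; rewrite !inE.
  by case: (boundary B =P T) => [->|_]; rewrite ?andbF // T2 eqxx !andbT.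
have cnt : \sum_(T : {set G} | #|T| == 2) lambda x (C0 G)
    = 'C(#|G|, 2)%:R * lambda x (C0 G).
  rewrite sumr_const -[LHS]mulr_natl -(card_draws G 2); congr (_%:R * _).
  by apply: eq_card => T; rewrite !inE.
have n2 : 2 * 'C(#|G|, 2)%:R = n * n - n :> R.
  rewrite /n -natrM mul2n -{1}[#|G|]/(#|G|)%N bin2 -natrM.
  have -> : (#|G| * #|G|.-1)./2.*2 = (#|G| * #|G|.-1)%N.
    by rewrite halfK; case: (#|G|) => // k; rewrite oddM /= andNb subn0.
  by case: (#|G|) => [|k]; rewrite /= ?muln0 ?subrr // [(k.+1 * k.+1)%N]mulnSr natrD addrK.
have := b finset.set0; rewrite -C0E => b0.
rewrite cnt in b2; have n0 : 0 <= n by rewrite ler0n.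
have l0 := lambda_gt0 G x_gt0.
apply: le_trans (lerD (ler_wpM2l n0 b0) (ler_wpM2l (ler0n _ 2) b2)) _.
by rewrite mulrA n2 -mulrDl expr2 addrC subrK.
Qed.

Definition normalizer : R := n * lambda x (C0 G) + 2 * lambda x (C2 G).

Lemma sum_weight : \sum_(a : worm G) worm_weight x a = normalizer.
Proof.
rewrite /normalizer -(sum_worms (fun A => x ^+ #|A|)).
by apply: eq_bigr => a _; rewrite mulrC.
Qed.

Lemma normalizer_le : normalizer <= n ^+ 2 * lambda x (C0 G).
Proof.
rewrite -sum_weight; apply: le_trans (sum_psi_shift (finset.sub0set _)).
by apply: ler_sum => a _; rewrite symdiff0 mulrC.
Qed.

Lemma reindex_worms F (h : {set {set G}} -> R) : F \in C0 G ->
  \sum_(a : worm G) psi R a * h (val a) = \sum_(a : worm G) psi R a * h (val a :+: F).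
Proof.
move=> F0; rewrite -(big_sub (mem (worms G)) (fun A => set_psi A * h A)) /=.
rewrite -(big_sub (mem (worms G)) (fun A => set_psi A * h (A :+: F))) /=.
rewrite (reindex_inj (@symdiff_inj _ F)) /=.
apply: eq_big => [A|A _]; first by rewrite worms_symdiff.
by rewrite /set_psi C0_symdiff.
Qed.

Section Flow.
Hypothesis n_gt0 : (0 < #|G|)%N.
Context (f : worm G -> R).

(* f extended by zero to all edge sets *)
Let g A : R := if insub A is Some a then f a else 0.

Let gE a : g (val a) = f a. Proof. by rewrite /g valK. Qed.

Definition energy a b : R := worm_weight x a * worm_matrix x a b * (f a - f b) ^+ 2.

Lemma energy_ge0 a b : 0 <= energy a b.
Proof.
by rewrite mulr_ge0 ?sqr_ge0 // mulr_ge0 ?worm_matrix_ge0 // ltW // worm_weight_gt0.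
Qed.

(** The energy of the transition that toggles e in A, which is zero unless both
    A and A :+: [set e] are worms. *)
Definition edge_energy e A : R :=
  \sum_(a | val a == A) \sum_(b | val b == val a :+: [set e]) energy a b.

Lemma edge_energy_ge0 e A : 0 <= edge_energy e A.
Proof. by apply: sumr_ge0 => a _; apply: sumr_ge0 => b _; apply: energy_ge0. Qed.

Lemma edge_energy_ge e A : e \in edges G -> A \in worms G -> A :+: [set e] \in worms G ->
  x ^+ #|e |: A| * (g A - g (A :+: [set e])) ^+ 2 <= 2 * Dmax * edge_energy e A.
Proof.
move=> /edgesP[u [v [uv ->]]] AW BW; set B := _ :+: _ in BW *.
pose a : worm G := exist _ A AW; pose b : worm G := exist _ B BW.
have mv : moved a b u v by rewrite /moved uv eqxx.
have -> : edge_energy [set u; v] A = energy a b.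
  rewrite /edge_energy (big_pred1 a) => [|c]; last by rewrite -val_eqE.
  by rewrite (big_pred1 b) // => c; rewrite -val_eqE.
rewrite -[A]/(val a) -[B]/(val b) !gE /energy [leRHS]mulrA.
apply: ler_wpM2r; first exact: sqr_ge0.
have := worm_flow_ge x01 mv.
by rewrite /worm_matrix; case: eqP => // ab; have := moved_neq mv; rewrite ab eqxx.
Qed.

(** A transition between distinct worms toggles a single edge. *)
Lemma sum_edge_energy :
  \sum_(e in edges G) \sum_(A in worms G) edge_energy e A
    <= \sum_a \sum_b energy a b.
Proof.
have -> : \sum_(e in edges G) \sum_(A in worms G) edge_energy e A
    = \sum_a \sum_(e in edges G) \sum_(b | val b == val a :+: [set e]) energy a b.
  rewrite [RHS]exchange_big; apply: eq_bigr => e _ /=.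
  rewrite (big_sub (mem (worms G)) (edge_energy e)); apply: eq_bigr => a _ /=.
  by rewrite /edge_energy (big_pred1 a) // => c; rewrite val_eqE.
apply: ler_sum => a _; rewrite (exchange_big_dep predT) //=.
apply: ler_sum => b _.
case: (pickP (fun e => (e \in edges G) && (val b == val a :+: [set e]))) => [e He|none].
  rewrite (big_pred1 e) // => e' /=; apply/idP/eqP => [He'|->//].
  case/andP: He He' => _ /eqP-> /andP[_ /eqP E].
  by apply: finset.set1_inj; rewrite -(symdiffKl (val a) [set e]) E symdiffKl.
by rewrite big_pred0 ?energy_ge0.
Qed.

(** The increment of f along the path from F to the worm d :+: F, with the
    weights of its two ends redistributed over the transitions. *)
Lemma path_bound F : F \in C0 G -> forall (d : worm G) (S : {set G} -> {set {set G}}),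
  (forall e, e \in val d ->
     [/\ e \in S e, S e \subset val d, S e \in worms G & S e :+: [set e] \in worms G]) ->
  (forall h : {set {set G}} -> R,
     h (val d) - h finset.set0 = \sum_(e in val d) (h (S e) - h (S e :+: [set e]))) ->
  x ^+ #|F| * (x ^+ #|val d :+: F| * (g (val d :+: F) - g F) ^+ 2)
    <= m * (2 * Dmax) * \sum_(e in val d)
         x ^+ #|val d :+: (e |: (S e :+: F))| * edge_energy e (S e :+: F).
Proof.
move=> F0 d S SP ST; have := ST (fun A => g (A :+: F)).
rewrite [finset.set0 :+: F]symdiffC symdiff0 => ->.
have dE : val d \subset edges G by have := valP d; rewrite wormsE => /andP[].
apply: (@le_trans _ _ (x ^+ #|F| * (x ^+ #|val d :+: F| * (m
    * \sum_(e in val d) (g (S e :+: F) - g (S e :+: [set e] :+: F)) ^+ 2)))).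
  rewrite !ler_wpM2l ?exprn_ge0 //; apply: le_trans (sqr_sum_le _ _) _.
  apply: ler_wpM2r; first by apply: sumr_ge0 => e _; apply: sqr_ge0.
  by rewrite ler_nat subset_leq_card.
rewrite -[leRHS]mulrA [leLHS](_ : _ = m * \sum_(e in val d) x ^+ (#|F| + #|val d :+: F|)
    * (g (S e :+: F) - g (S e :+: [set e] :+: F)) ^+ 2); last first.
  rewrite -mulr_sumr exprD; move: (x ^+ #|F|) (x ^+ #|val d :+: F|) => p q.
  by move: (\sum_(e in _) _) => y; ring.
apply: ler_wpM2l; first exact: ler0n.
rewrite mulr_sumr; apply: ler_sum => e ed; have [eS Sd SW S'W] := SP e ed.
have -> : S e :+: [set e] :+: F = S e :+: F :+: [set e].
  by rewrite -!symdiffA; congr (_ :+: _); exact: symdiffC.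
rewrite [S e :+: F]symdiffC (exchange_card F Sd eS) exprD -mulrA mulrCA.
rewrite [leRHS]mulrCA ler_wpM2l ?exprn_ge0 // symdiffC.
apply: edge_energy_ge; first exact: (fintype.subsetP dE).
  by rewrite worms_symdiff.
by rewrite -symdiffA [F :+: _]symdiffC symdiffA worms_symdiff.
Qed.

(** Summing the path bounds over F in C0 and over d, and exchanging the sums, a
    transition at the worm A that toggles e receives the load
    [sum_psi_shift] with the edge set e |: A. *)
Lemma worm_poincare_weight : \sum_a worm_weight x a * f a = 0 ->
  \sum_a worm_weight x a * f a ^+ 2
    <= 2 * Dmax * m * n ^+ 2 * \sum_a \sum_b energy a b.
Proof.
move=> f0; set V := (X in X <= _); have l0 := lambda_gt0 G x_gt0.
have Z0 : 0 <= \sum_(a : worm G) worm_weight x a.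
  by apply: sumr_ge0 => a _; apply/ltW/worm_weight_gt0.
have /choice[S SP] := fun d : worm G => unwinding (valP d).
rewrite -(ler_pM2l l0).
(* any constant in place of the mean increases the variance *)
have var_le (c : R) : V <= \sum_a worm_weight x a * (f a - c) ^+ 2.
  have -> : \sum_a worm_weight x a * (f a - c) ^+ 2
      = V - 2 * c * (\sum_a worm_weight x a * f a)
        + c ^+ 2 * (\sum_(a : worm G) worm_weight x a).
    rewrite /V !mulr_sumr -sumrN -!big_split; apply: eq_bigr => a _ /=; ring.
  by rewrite f0 mulr0 subr0 lerDl mulr_ge0 ?sqr_ge0.
(* the charge of the edge e of d at the worm A through which its path goes *)
pose K (d : worm G) e A := m * (2 * Dmax) * psi R d *
  (x ^+ #|val d :+: (e |: A)| * edge_energy e A).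
have psi0 (d : worm G) : 0 <= psi R d by rewrite /psi; case: ifP; rewrite ler0n.
have K0 d e A : 0 <= K d e A.
  by rewrite /K !mulr_ge0 ?exprn_ge0 ?edge_energy_ge0 ?ler0n.
apply: (@le_trans _ _ (\sum_(F in C0 G) \sum_(d : worm G)
    \sum_(e in val d) K d e (S d e :+: F))).
  rewrite [in leLHS]/lambda mulr_suml; apply: ler_sum => F F0.
  apply: (@le_trans _ _ (x ^+ #|F| * \sum_a worm_weight x a * (f a - g F) ^+ 2)).
    by rewrite ler_wpM2l ?exprn_ge0.
  have -> : \sum_a worm_weight x a * (f a - g F) ^+ 2
      = \sum_(d : worm G) psi R d * (x ^+ #|val d :+: F| * (g (val d :+: F) - g F) ^+ 2).
    rewrite -(reindex_worms (fun A => x ^+ #|A| * (g A - g F) ^+ 2) F0).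
    by apply: eq_bigr => a _; rewrite gE /worm_weight [x ^+ _ * psi R a]mulrC mulrA.
  rewrite mulr_sumr; apply: ler_sum => d _; have [SP1 SP2] := SP d.
  rewrite mulrCA; apply: le_trans (ler_wpM2l (psi0 d) (path_bound F0 SP1 (SP2 R))) _.
  rewrite [leLHS]mulrA mulr_sumr; apply: ler_sum => e _.
  by rewrite /K [psi R d * _]mulrC.
apply: (@le_trans _ _ (\sum_(d : worm G) \sum_(e in edges G) \sum_(A in worms G) K d e A)).
  rewrite exchange_big; apply: ler_sum => d _ /=.
  have dE : val d \subset edges G by have := valP d; rewrite wormsE => /andP[].
  rewrite exchange_big /= [leRHS](big_setID (val d)) /= (finset.setIidPr dE).
  rewrite -[leLHS]addr0; apply: lerD; last first.
    by apply: sumr_ge0 => e _; apply: sumr_ge0.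
  apply: ler_sum => e ed; have [_ _ SW _] := (SP d).1 e ed.
  (* distinct F give distinct worms S d e :+: F *)
  rewrite [leRHS](reindex_inj (@symdiff_inj _ (S d e))) /=.
  rewrite [leLHS]big_mkcond [leRHS]big_mkcond; apply: ler_sum => F _.
  case: ifP => F0; last by case: ifP => // _; rewrite K0.
  by rewrite [F :+: S d e]symdiffC worms_symdiff // SW.
rewrite exchange_big /=; under eq_bigr do rewrite exchange_big /=.
apply: (@le_trans _ _ (\sum_(e in edges G) \sum_(A in worms G)
   m * (2 * Dmax) * (n ^+ 2 * lambda x (C0 G)) * edge_energy e A)).
  apply: ler_sum => e eE; apply: ler_sum => A AW.
  have -> : \sum_(d : worm G) K d e A = m * (2 * Dmax)
      * (\sum_(d : worm G) psi R d * x ^+ #|val d :+: (e |: A)|) * edge_energy e A.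
    rewrite [X in X * _]mulr_sumr [RHS]mulr_suml; apply: eq_bigr => d _; rewrite /K.
    by rewrite -!mulrA.
  apply: ler_wpM2r; first exact: edge_energy_ge0.
  apply: ler_wpM2l; first by rewrite !mulr_ge0 ?ler0n.
  apply: sum_psi_shift; rewrite finset.subUset finset.sub1set eE /=.
  by move: AW; rewrite wormsE => /andP[].
have -> : \sum_(e in edges G) \sum_(A in worms G)
     m * (2 * Dmax) * (n ^+ 2 * lambda x (C0 G)) * edge_energy e A
  = lambda x (C0 G) * (2 * Dmax * m * n ^+ 2
     * \sum_(e in edges G) \sum_(A in worms G) edge_energy e A).
  rewrite [RHS]mulrA [RHS]mulr_sumr; apply: eq_bigr => e _; rewrite [RHS]mulr_sumr.
  apply: eq_bigr => A _; move: (lambda _ _) (edge_energy _ _) (n ^+ 2) => l y k.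
  by move: m Dmax => m' D'; ring.
rewrite !ler_wpM2l ?(ltW l0) //; last exact: sum_edge_energy.
by rewrite !mulr_ge0 ?ler0n ?sqr_ge0.
Qed.

End Flow.

Hypothesis n_gt0 : (0 < #|G|)%N.

Lemma normalizer_gt0 : 0 < normalizer.
Proof.
rewrite -sum_weight (bigD1 (worm0 G)) //= ltr_pwDl ?worm_weight_gt0 //.
by apply: sumr_ge0 => a _; apply/ltW/worm_weight_gt0.
Qed.

Lemma ps_massE a : ps_mass x a = worm_weight x a / normalizer.
Proof. by []. Qed.

Lemma ps_mass_gt0 a : 0 < ps_mass x a.
Proof. by rewrite ps_massE divr_gt0 ?normalizer_gt0 ?worm_weight_gt0. Qed.

Lemma ps_mass_sum : \sum_(a : worm G) ps_mass x a = 1.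
Proof. by rewrite -mulr_suml sum_weight divff // gt_eqF ?normalizer_gt0. Qed.

Lemma ps_mass_balance a b :
  ps_mass x a * worm_matrix x a b = ps_mass x b * worm_matrix x b a.
Proof. by rewrite !ps_massE mulrAC worm_matrix_balance // mulrAC. Qed.

Lemma worm_poincare (f : worm G -> R) : avg (ps_mass x) f = 0 ->
  inner (ps_mass x) f f
    <= 4 * Dmax * m * n ^+ 2 * dirichlet (worm_matrix x) (ps_mass x) f.
Proof.
have Z0 := normalizer_gt0.
have avgE (h : worm G -> R) :
    avg (ps_mass x) h = (\sum_a worm_weight x a * h a) / normalizer.
  by rewrite /avg mulr_suml; apply: eq_bigr => a _; rewrite ps_massE mulrAC.
rewrite avgE => /eqP; rewrite mulf_eq0 invr_eq0 [normalizer == 0]gt_eqF // orbF => /eqP f0.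
have := worm_poincare_weight n_gt0 f0.
have -> : inner (ps_mass x) f f = (\sum_a worm_weight x a * f a ^+ 2) / normalizer.
  by rewrite /inner avgE; under eq_bigr do rewrite -expr2.
have -> : dirichlet (worm_matrix x) (ps_mass x) f
    = 2^-1 * ((\sum_a \sum_b energy f a b) / normalizer).
  rewrite /dirichlet; congr (_ * _); rewrite mulr_suml; apply: eq_bigr => a _.
  rewrite mulr_suml; apply: eq_bigr => b _.
  by rewrite /energy ps_massE; ring.
rewrite -(ler_pM2r (_ : 0 < normalizer^-1)) ?invr_gt0 //.
move/le_trans; apply; rewrite le_eqVlt; apply/orP; left; apply/eqP.
by field; rewrite gt_eqF.
Qed.

End Poincare.

(** * Sizes of a graph and of its worm ensemble *)

Section Sizes.
Context (G : sgraph).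

Lemma card_vertices_ge2 : (0 < #|edges G|)%N -> (2 <= #|G|)%N.
Proof.
case/card_gt0P => e /edgesP[u [v [uv _]]].
by have := max_card (mem [set u; v]); rewrite cards2 (adj_neq uv).
Qed.

Lemma max_degree_gt0 : (0 < #|edges G|)%N -> (0 < max_degree G)%N.
Proof.
case/card_gt0P => e /edgesP[u [v [uv _]]].
apply: leq_trans (leq_bigmax (F := @degree G) u).
by apply/card_gt0P; exists v; rewrite inE.
Qed.

Lemma max_degree_le : (max_degree G <= #|G|)%N.
Proof. by apply/bigmax_leqP => u _; apply: max_card. Qed.

Lemma card_edges_le : (#|edges G| <= #|G| ^ 2)%N.
Proof.
apply: (@leq_trans #|[set [set p.1; p.2] | p in [set: G * G]]|).
  apply/subset_leq_card/fintype.subsetP => e /edgesP[u [v [_ ->]]].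
  by apply/imsetP; exists (u, v).
by apply: leq_trans (leq_imset_card _ _) _; rewrite cardsT card_prod mulnn.
Qed.

End Sizes.

Section Masses.
Context (R : realType) (G : sgraph) (x : R).
Hypothesis x01 : 0 < x < 1.
Hypothesis edge : (0 < #|edges G|)%N.
Implicit Types (u v : G).

Let n : R := #|G|%:R.
Let n2 : 2 <= n. Proof. by rewrite ler_nat card_vertices_ge2. Qed.
Let n_gt0 : (0 < #|G|)%N. Proof. exact: ltnW (card_vertices_ge2 edge). Qed.
Let x_gt0 : 0 < x. Proof. by case/andP: x01. Qed.
Let x_le1 : x <= 1. Proof. by case/andP: x01 => _ /ltW. Qed.

Lemma ps_measure_avg (S : {set {set {set G}}}) :
  ps_measure x S = avg (@ps_mass R G x) (fun a => (val a \in S)%:R).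
Proof.
rewrite /ps_measure /avg big_mkcond; apply: eq_bigr => a _.
by case: (val a \in S); rewrite ?mulr1 ?mulr0.
Qed.

Lemma ps_measure_weight (S : {set {set {set G}}}) : ps_measure x S
  = (n * \sum_(A in C0 G) (x ^+ #|A| * (A \in S)%:R)
     + 2 * \sum_(A in C2 G) (x ^+ #|A| * (A \in S)%:R)) / normalizer G x.
Proof.
rewrite -(sum_worms (fun A => x ^+ #|A| * (A \in S)%:R)) mulr_suml ps_measure_avg.
apply: eq_bigr => a _; rewrite ps_massE /worm_weight mulrAC; congr (_ / _).
by rewrite [x ^+ _ * psi R a]mulrC -mulrA.
Qed.

Lemma ps_measure_C0 : ps_measure x (C0 G) = n * lambda x (C0 G) / normalizer G x.
Proof.
rewrite ps_measure_weight [X in _ + 2 * X]big1 => [|A].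
  by rewrite mulr0 addr0; under eq_bigr => A A0 do rewrite A0 mulr1.
rewrite !inE => /andP[-> /eqP b2]; rewrite -cards_eq0 b2 andbF mulr0 //.
Qed.

Lemma ps_measure_Cuv u v : u != v ->
  ps_measure x (Cuv u v) = 2 * lambda x (Cuv u v) / normalizer G x.
Proof.
move=> uv; have c2 : #|[set u; v]| = 2 by rewrite cards2 uv.
rewrite ps_measure_weight [X in n * X]big1 => [|A].
  rewrite mulr0 add0r; congr (2 * _ / _).
  rewrite /lambda big_mkcond [RHS]big_mkcond; apply: eq_bigr => A _ /=.
  rewrite !inE; case: (A \subset _) => //=.
  by case: (boundary A =P _) => [->|_]; rewrite ?c2 ?eqxx ?mulr1 ?mulr0 //; case: ifP.
rewrite !inE => /andP[-> /eqP ->].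
by rewrite eq_sym -cards_eq0 c2 mulr0.
Qed.

Lemma worm_notin_Cuu u (a : worm G) : (val a \in Cuv u u) = false.
Proof.
apply/negP; rewrite inE => /andP[_ /eqP b].
by have := valP a; rewrite wormsE b finset.setUid cards1 andbF.
Qed.

(** Both lower bounds come from the normalizer being at most n^2 lambda(C0);
    this one also uses n >= 2. *)
Lemma ps_measure_C0_ge k : 2 * x ^+ k / n ^+ 2 <= ps_measure x (C0 G).
Proof.
have l0 := lambda_gt0 G x_gt0; have Z := normalizer_le G x01.
have Z0 := normalizer_gt0 x01 n_gt0; have n0 : 0 < n by move: n2; lra.
rewrite ps_measure_C0 ler_pdivlMr // mulrAC ler_pdivrMr ?exprn_gt0 //.
apply: (@le_trans _ _ (2 * (n ^+ 2 * lambda x (C0 G)))).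
  rewrite -mulrA ler_wpM2l //; apply: le_trans Z; rewrite ler_piMl ?(ltW Z0) //.
  by rewrite exprn_ile1 // ltW.
rewrite -[leRHS]mulrA [lambda _ _ * _]mulrC.
by apply: ler_wpM2r; rewrite // mulr_ge0 ?sqr_ge0 ?ltW.
Qed.

Lemma ps_measure_Cuv_ge u v k : connected_graph G -> u != v -> (gdist u v <= k)%N ->
  2 * x ^+ k / n ^+ 2 <= ps_measure x (Cuv u v).
Proof.
move=> Gc uv dk; have n0 : 0 < n by move: n2; lra.
have L := lambda_Cuv_ge x01 Gc uv dk; have Z := normalizer_le G x01.
have Z0 := normalizer_gt0 x01 n_gt0.
rewrite ps_measure_Cuv // ler_pdivlMr // mulrAC ler_pdivrMr ?exprn_gt0 //.
rewrite -!mulrA ler_wpM2l //; apply: (@le_trans _ _ (x ^+ k * (n ^+ 2 * lambda x (C0 G)))).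
  by rewrite ler_wpM2l // exprn_ge0 // ltW.
by rewrite mulrCA mulrC ler_wpM2r // sqr_ge0.
Qed.

(** The weight of the empty set is n, no worm has a larger one, and there are at
    most 2^m worms. *)
Lemma ps_mass_worm0 : 2^-1 ^+ #|edges G| <= ps_mass x (worm0 G).
Proof.
have Z0 := normalizer_gt0 x01 n_gt0; have n0 : 0 < n by move: n2; lra.
have -> : ps_mass x (worm0 G) = n / normalizer G x.
  rewrite ps_massE /worm_weight /psi /= cards0 expr0 mul1r.
  by rewrite inE finset.sub0set boundary0 eqxx.
rewrite ler_pdivlMr // exprVn mulrC ler_pdivrMr ?exprn_gt0 // -sum_weight.
apply: (@le_trans _ _ (\sum_(a : worm G) n)).
  apply: ler_sum => a _; apply: (@le_trans _ _ (psi R a)).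
    rewrite ler_piMl ?exprn_ile1 ?(ltW x_gt0) //.
    by rewrite /psi; case: ifP; rewrite ler0n.
  by rewrite /psi; case: ifP.
rewrite sumr_const -[leLHS]mulr_natr ler_wpM2l ?(ltW n0) //.
rewrite -natrX ler_nat -card_powerset card_sub.
apply/subset_leq_card/fintype.subsetP => A; rewrite powersetE.
by rewrite wormsE => /andP[].
Qed.

End Masses.

(** * Burn-in and sample size *)

Section Numerics.
Context (R : realType).
Implicit Types (y n D m delta theta q N T : R).

Lemma absz_ceil_ge y : y <= (`|Num.ceil y|%N)%:R.
Proof.
rewrite natr_absz; apply: le_trans (ceil_ge y) _.
by rewrite ler_int; apply: ler_norm.
Qed.

Lemma absz_ceil_le y : 0 <= y -> (`|Num.ceil y|%N)%:R <= y + 1.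
Proof.
move=> y0; have c0 : 0 <= Num.ceil y by rewrite ceil_ge0; lra.
rewrite natr_absz ger0_norm //; have := ceilB1_lt y; rewrite intrB; lra.
Qed.

Lemma expR_ln_burn (k : nat) delta : 0 < delta ->
  expR (- (k%:R * ln 2 + ln (4 * delta^-1))) = 2^-1 ^+ k * (delta / 4).
Proof.
move=> d0; rewrite opprD expRD !expRN expRM_natl !lnK ?posrE //; last first.
  by rewrite mulr_gt0 ?invr_gt0.
by rewrite exprVn; congr (_ * _); field; lra.
Qed.

(** The rate 1 - 1/(2T) needs the time 2T (k log 2 + log (4 / delta)), and
    n^2 >= 2. *)
Lemma contraction_power T n (k t : nat) delta : 1 <= T -> 2 <= n -> 0 < delta < 1 ->
  T * n ^+ 2 * (k%:R * ln 2 + ln (4 * delta^-1)) <= t%:R ->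
  (1 - (2 * T)^-1) ^+ t <= 2^-1 ^+ k * (delta / 4).
Proof.
move=> T1 n2 /andP[d0 d1] tT; rewrite -expR_ln_burn //.
set L := _ + _ in tT *.
have L0 : 0 <= L.
  rewrite addr_ge0 ?mulr_ge0 ?ln_ge0 //; first by lra.
  by rewrite ler_pdivlMr // mul1r; lra.
apply: (@le_trans _ _ (expR (- (2 * T)^-1) ^+ t)).
  rewrite lerXn2r ?nnegrE ?expR_ge0 //; first by rewrite subr_ge0 invf_le1; lra.
  by have := expR_ge1Dx (- (2 * T)^-1).
rewrite -expRM_natl ler_expR mulrN lerN2 ler_pdivlMr; last by lra.
apply: le_trans tT; rewrite mulrC; apply: ler_wpM2r => //.
by rewrite mulrC; apply: ler_wpM2l; [lra|rewrite expr2; nra].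
Qed.

(** Here y stands for x^k.  The product N q theta^2 is at least
    32 D m n^4 / delta, and half of n^2 is at least 1. *)
Lemma chebyshev_numeric n D m delta theta q y N :
  2 <= n -> 1 <= D -> 1 <= m -> 0 < delta -> 0 < theta -> 0 < y ->
  2 * y / n ^+ 2 <= q -> 16 * D * m * n ^+ 6 / (delta * theta ^+ 2 * y) <= N ->
  4 * (4 * D * m * n ^+ 2) * q / (N * (theta * q) ^+ 2) <= delta / 4.
Proof.
move=> n2 D1 m1 d0 t0 y0 Hq HN.
have n0 : 0 < n by lra.
have D0 : 0 < D by lra.
have m0 : 0 < m by lra.
have A0 : 0 < 2 * y / n ^+ 2 by rewrite divr_gt0 ?exprn_gt0 ?mulr_gt0.
have B0 : 0 < 16 * D * m * n ^+ 6 / (delta * theta ^+ 2 * y).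
  by rewrite divr_gt0 ?mulr_gt0 ?exprn_gt0.
have q0 := lt_le_trans A0 Hq; have N0 := lt_le_trans B0 HN.
have K : 32 * D * m * n ^+ 4 / (delta * theta ^+ 2) <= N * q.
  have := ler_pM (ltW B0) (ltW A0) HN Hq; congr (_ <= _).
  by field; rewrite !gt_eqF.
rewrite ler_pdivrMr ?mulr_gt0 ?exprn_gt0 ?mulr_gt0 //.
rewrite ler_pdivrMr ?mulr_gt0 ?exprn_gt0 // in K.
have -> : delta / 4 * (N * (theta * q) ^+ 2)
   = 4^-1 * q * (N * q * (delta * theta ^+ 2)) by field.
apply: le_trans (ler_wpM2l _ K); last by rewrite mulr_ge0 // ltW.
have -> : 4^-1 * q * (32 * D * m * n ^+ 4)
  = 4 * (4 * D * m * n ^+ 2) * q * (n ^+ 2 / 2) by field.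
apply: ler_peMr; first by rewrite !mulr_ge0 ?exprn_ge0 // ltW.
by rewrite ler_pdivlMr // mul1r expr2; nra.
Qed.

(** Relative errors eps / (2 + eps) in numerator and denominator amount to a
    factor between 1 / (1 + eps) and 1 + eps in the quotient. *)
Lemma ratio_error (eps a b p r c : R) : 0 < eps < 1 -> 0 < p -> 0 < r -> 0 <= c ->
  `|a - p| <= eps / (2 + eps) * p -> `|b - r| <= eps / (2 + eps) * r ->
  `|c * (a / b) - c * (p / r)| <= eps * (c * (p / r)).
Proof.
move=> /andP[e0 e1] p0 r0 c0.
set t := eps / (2 + eps).
have t0 : 0 < t by rewrite divr_gt0 //; lra.
have tE : t * (2 + eps) = eps by rewrite mulfVK // gt_eqF //; lra.
have t1 : t < 1 by rewrite ltr_pdivrMr; lra.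
rewrite !ler_distl => /andP[a1 a2] /andP[b1 b2].
have b0 : 0 < b by nra.
have hi : a / b <= (1 + eps) * (p / r).
  rewrite ler_pdivrMr // mulrAC mulrA ler_pdivlMr //.
  have tE' : 1 + t = (1 + eps) * (1 - t) by move: tE; lra.
  apply: (@le_trans _ _ ((1 + eps) * p * ((1 - t) * r))).
    rewrite [leRHS](_ : _ = (1 + eps) * (1 - t) * p * r); last by ring.
    by rewrite -tE' ler_pM2r //; lra.
  by rewrite [leRHS]mulrAC; apply: ler_wpM2l; [rewrite mulr_ge0; lra|lra].
have lo : (1 - eps) * (p / r) <= a / b.
  rewrite ler_pdivlMr // mulrAC mulrA ler_pdivrMr //.
  apply: (@le_trans _ _ ((1 - eps) * p * ((1 + t) * r))).
    by rewrite [leLHS]mulrAC; apply: ler_wpM2l; [rewrite mulr_ge0; lra|lra].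
  rewrite [leLHS](_ : _ = (1 - eps) * (1 + t) * p * r); last by ring.
  rewrite ler_pM2r //; apply: (@le_trans _ _ ((1 - t) * p)); last by lra.
  by rewrite ler_pM2r //; nra.
have := ler_wpM2l c0 hi; have := ler_wpM2l c0 lo.
by move: (p / r) (a / b) => z w; lra.
Qed.

(** The constant is 144 for the sample size, as (2 + eps)^2 <= 9, plus 20 for the
    burn-in, as log 2 <= 1 and log (4 / delta) <= 4 / delta, plus 2 for the two
    ceilings; L2 and L4 stand for the logarithms and y for x^k. *)
Lemma base_bound (n D m delta eps y L2 L4 : R) :
  2 <= n -> 1 <= D -> 1 <= m -> m <= n ^+ 2 -> 0 < delta < 1 -> 0 < eps < 1 ->
  0 < y <= 1 -> L2 <= 1 -> L4 <= 4 * delta^-1 ->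
  (16 * eps ^- 2 * (2 + eps) ^+ 2 * delta^-1 * D * m * n ^+ 6 * y^-1 + 1)
    + (4 * (L2 + L4 / m) * D * m ^+ 2 * n ^+ 4 + 1)
  <= 166 * (eps ^- 2 * delta^-1 * D * m * n ^+ 6 * y^-1).
Proof.
move=> n2 D1 m1 mn /andP[d0 d1] /andP[e0 e1] /andP[y0 y1] L2b L4b.
set b := eps ^- 2 * _ * _ * _ * _ * _.
have i1 : 1 <= delta^-1 by rewrite invf_ge1 // ltW.
have i2 : 1 <= y^-1 by rewrite invf_ge1.
have i3 : 1 <= eps ^- 2 by rewrite invf_ge1 ?exprn_gt0 // exprn_ile1 // ltW.
have n1 : 1 <= n by lra.
have ge1M (u v : R) : 1 <= u -> 1 <= v -> 1 <= u * v by move=> *; nra.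
set z := delta^-1 * D * m * n ^+ 6.
have z1 : 1 <= z by rewrite !ge1M ?exprn_ege1.
have bE : b = eps ^- 2 * y^-1 * z by rewrite /b /z; ring.
have zb : z <= b.
  by rewrite bE ler_peMl ?ge1M //; lra.
have P1 : 16 * eps ^- 2 * (2 + eps) ^+ 2 * delta^-1 * D * m * n ^+ 6 * y^-1
    = 16 * (2 + eps) ^+ 2 * b by rewrite /b; ring.
have P2 : 16 * (2 + eps) ^+ 2 * b <= 144 * b.
  apply: ler_wpM2r; first by lra.
  by rewrite expr2; nra.
have m0 : 0 < m by lra.
have P3 : 4 * (L2 + L4 / m) * D * m ^+ 2 * n ^+ 4 = 4 * (m * L2 + L4) * (D * m * n ^+ 4).
  by field; rewrite gt_eqF.
have Q0 : 0 <= D * m * n ^+ 4 by rewrite !mulr_ge0 ?exprn_ge0 //; lra.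
have P4 : m * L2 + L4 <= 5 * (n ^+ 2 * delta^-1).
  have h1 : m * L2 <= n ^+ 2 * delta^-1.
    apply: (@le_trans _ _ (n ^+ 2)); last by rewrite ler_peMr // exprn_ge0 //; lra.
    by apply: le_trans mn; rewrite ler_piMr // ltW.
  have h2 : 4 * delta^-1 <= 4 * (n ^+ 2 * delta^-1).
    by rewrite ler_pM2l // ler_peMl ?exprn_ege1 //; lra.
  by lra.
have P5 : 4 * (m * L2 + L4) * (D * m * n ^+ 4) <= 20 * z.
  rewrite [leRHS](_ : _ = 4 * (5 * (n ^+ 2 * delta^-1)) * (D * m * n ^+ 4)); last by rewrite /z; ring.
  by apply: ler_wpM2r => //; lra.
by rewrite P1 P3; lra.
Qed.

End Numerics.

(** * Trajectories *)

Section Trajectories.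
Context (R : realType) (G : sgraph) (x : R).
Hypothesis x01 : 0 < x < 1.
Hypothesis n_gt0 : (0 < #|G|)%N.
Context (T : nat).
Implicit Types (w : {ffun 'I_T.+1 -> worm G}).

Definition trajectory w (t : nat) : worm G := w (inord t).

Lemma sum_traj_prob (Q : pred {ffun 'I_T.+1 -> worm G}) :
  \sum_(w | Q w) traj_prob x T (trajectory w)
  = path_mean (@worm_matrix R G x) T
      (fun p => (Q [ffun i : 'I_T.+1 => nth (worm0 G) (worm0 G :: p) i])%:R) (worm0 G).
Proof.
rewrite -(sum_trajectories (@worm_matrix R G x) (fun w => (Q w)%:R : R)) big_mkcond.
apply: eq_bigr => w _; rewrite /traj_prob /trajectory.
by case: (Q w); rewrite ?mulr1 ?mulr0.
Qed.

Lemma traj_prob_ge0 w : 0 <= traj_prob x T (trajectory w).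
Proof.
by rewrite mulr_ge0 ?ler0n // prodr_ge0 // => t _; apply: worm_matrix_ge0.
Qed.

Lemma traj_prob_sum : \sum_w traj_prob x T (trajectory w) = 1.
Proof.
rewrite (sum_traj_prob predT) /=.
by rewrite (path_mean_cst (@worm_matrix_sum R G x)).
Qed.

Lemma traj_prob_compl (Q : pred {ffun 'I_T.+1 -> worm G}) (d : R) :
  \sum_(w | ~~ Q w) traj_prob x T (trajectory w) <= d ->
  1 - d <= \sum_(w | Q w) traj_prob x T (trajectory w).
Proof. by move=> H; rewrite -traj_prob_sum (bigID Q) /=; lra. Qed.

(** Union bound: Q can only fail where Q1 or Q2 does. *)
Lemma traj_prob_union (Q Q1 Q2 : pred {ffun 'I_T.+1 -> worm G}) (d1 d2 : R) :
  (forall w, Q1 w -> Q2 w -> Q w) ->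
  \sum_(w | ~~ Q1 w) traj_prob x T (trajectory w) <= d1 ->
  \sum_(w | ~~ Q2 w) traj_prob x T (trajectory w) <= d2 ->
  \sum_(w | ~~ Q w) traj_prob x T (trajectory w) <= d1 + d2.
Proof.
move=> H h1 h2; apply: le_trans (lerD h1 h2).
rewrite [X in X + _]big_mkcond [X in _ + X]big_mkcond [leLHS]big_mkcond -big_split.
apply: ler_sum => w _ /=; have p0 := traj_prob_ge0 w; have := H w.
case: (Q w) => /= [_|]; first by rewrite addr_ge0 //; case: ifP.
by case: (Q1 w); case: (Q2 w) => //= H'; [have := H' isT isT|lra|lra|lra].
Qed.

(** An event that depends on finitely many times has the probability given by
    the trajectory weights. *)
Lemma process_prob (d : measure_display) (Om : measurableType d)
    (P : probability Om R) (X : nat -> Om -> worm G) (Q : pred {ffun 'I_T.+1 -> worm G}) :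
  is_worm_process P x X ->
  P [set o | Q [ffun i : 'I_T.+1 => X i o]]%classic
  = (\sum_(w | Q w) traj_prob x T (trajectory w))%:E.
Proof.
case=> mX PX.
pose cyl w := [set o | forall t, (t <= T)%N -> X t o = trajectory w t]%classic.
pose r := [seq w <- enum {: {ffun 'I_T.+1 -> worm G}} | Q w].
have ffunK w o : cyl w o <-> [ffun i : 'I_T.+1 => X i o] = w.
  split=> [H|<- t tT].
    by apply/ffunP => i; rewrite ffunE H ?/trajectory ?inord_val // -ltnS.
  by rewrite /trajectory ffunE inordK.
have -> : [set o | Q [ffun i : 'I_T.+1 => X i o]]%classic
    = (\bigcup_(w in [set` r]) cyl w)%classic.
  apply/seteqP; split=> o /=.
    move=> Qo; exists [ffun i : 'I_T.+1 => X i o]; last exact/ffunK.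
    by rewrite /= mem_filter Qo mem_enum.
  by case=> w /=; rewrite mem_filter => /andP[Qw _] /ffunK ->.
rewrite measure_fin_bigcup //.
- rewrite -fsbig_seq; last by rewrite filter_uniq ?enum_uniq.
  rewrite /r big_filter big_enum_cond /=.
  rewrite -sumEFin; apply: eq_bigr => w _; exact: PX.
- by move=> w w' _ _; case=> o; case=> /ffunK <- /ffunK <-.
- move=> w _.
  have -> : cyl w = (\bigcap_(t in `I_T.+1) [set o | X t o = trajectory w t])%classic.
    by apply/seteqP; split=> o H t; [move=> /= tT; apply: H|move=> tT; apply: H].
  by apply: fin_bigcap_measurable => //; exact: finite_II.
Qed.

Lemma process_approximation (d : measure_display) (Om : measurableType d)
    (P : probability Om R) (X : nat -> Om -> worm G)
    (Y : (nat -> worm G) -> R) (eps delta y : R) :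
  is_worm_process P x X ->
  (forall f f' : nat -> worm G, (forall t, (t <= T)%N -> f t = f' t) -> Y f = Y f') ->
  \sum_(w | ~~ (`|Y (trajectory w) - y| <= eps * y)) traj_prob x T (trajectory w) <= delta ->
  is_approximation P (fun o => Y (fun t => X t o)) eps delta y.
Proof.
move=> PX Yext bad; rewrite /is_approximation.
have -> : [set o | `|Y (fun t => X t o) - y| <= eps * y]%classic
    = [set o | (fun w => `|Y (trajectory w) - y| <= eps * y) [ffun i : 'I_T.+1 => X i o]]%classic.
  apply/seteqP; split=> o /=; rewrite (Yext (trajectory _) (fun t => X t o)) // => t tT;
  by rewrite /trajectory ffunE inordK.
rewrite (process_prob (fun w => `|Y (trajectory w) - y| <= eps * y) PX) lee_fin.
exact: traj_prob_compl.
Qed.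

End Trajectories.

(** * The estimators *)

Section Simulation.
Context (R : realType) (G : sgraph) (x eps delta : R) (k : nat).
Hypothesis x01 : 0 < x < 1.
Hypothesis edge : (0 < #|edges G|)%N.
Hypothesis eps01 : 0 < eps < 1.
Hypothesis delta01 : 0 < delta < 1.

Let n : R := #|G|%:R.
Let m : R := #|edges G|%:R.
Let Dmax : R := (max_degree G)%:R.
Let tau := burn_in G delta.
Let N := sample_size G x eps delta k.
Let theta : R := eps / (2 + eps).

Let n2 : 2 <= n. Proof. by rewrite ler_nat card_vertices_ge2. Qed.
Let n_gt0 : (0 < #|G|)%N. Proof. exact: ltnW (card_vertices_ge2 edge). Qed.
Let m1 : 1 <= m. Proof. by rewrite ler1n. Qed.
Let D1 : 1 <= Dmax. Proof. by rewrite ler1n max_degree_gt0. Qed.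
Let y0 : 0 < x ^+ k. Proof. by case/andP: x01 => x0 _; rewrite exprn_gt0. Qed.
Let theta_gt0 : 0 < theta. Proof. by case/andP: eps01 => *; rewrite divr_gt0 //; lra. Qed.

Lemma burn_in_ge : 4 * Dmax * m * n ^+ 2 * n ^+ 2 *
  (#|edges G|%:R * ln 2 + ln (4 * delta^-1)) <= tau%:R.
Proof.
apply: le_trans (absz_ceil_ge _); rewrite -/n -/m -/Dmax le_eqVlt; apply/orP; left.
move: (ln _) (ln _) n Dmax m m1 => l2 l4 n' D' m' m1'.
by apply/eqP; field; lra.
Qed.

Lemma sample_size_ge :
  16 * Dmax * m * n ^+ 6 / (delta * theta ^+ 2 * x ^+ k) <= N%:R.
Proof.
apply: le_trans (absz_ceil_ge _); rewrite -/n -/m -/Dmax le_eqVlt; apply/orP; left.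
rewrite /theta; move: y0; move: (x ^+ k) n Dmax m => y n' D' m' y0'.
case/andP: eps01 => e0 _; case/andP: delta01 => d0 _.
have e2 : 0 < 2 + eps by lra.
apply/eqP; field.
by rewrite (gt_eqF y0') (gt_eqF d0) (gt_eqF e0) (gt_eqF e2).
Qed.

Lemma sample_size_gt0 : (0 < N)%N.
Proof.
rewrite -(ltr0n R); apply: lt_le_trans sample_size_ge.
case/andP: delta01 => d0 _; case/andP: x01 => x_gt0 _.
have n0 : 0 < n by move: n2; lra.
have m0 : 0 < m by move: m1; lra.
have D0 : 0 < Dmax by move: D1; lra.
by move: theta theta_gt0 => th th0; rewrite divr_gt0 ?mulr_gt0 ?exprn_gt0.
Qed.

(** Here p lists X_1, ..., X_(tau + N); dropping tau entries leaves the sample. *)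
Lemma time_averageE (S : {set {set {set G}}}) (w : nat -> worm G) (a : worm G) (p : seq (worm G)) :
  size p = (tau + N)%N -> (forall t, (t <= tau + N)%N -> w t = nth a (a :: p) t) ->
  time_average R tau N S w = N%:R^-1 * \sum_(b <- drop tau p) (val b \in S)%:R.
Proof.
move=> sp wp; rewrite /time_average; congr (_ * _).
rewrite (big_nth a) size_drop sp addKn big_add1 /= -{1}[tau]add0n big_addn addKn.
rewrite big_nat_cond [RHS]big_nat_cond; apply: eq_bigr => t; rewrite andbT => /andP[_ tN].
have le_t : ((t + tau).+1 <= tau + N)%N by rewrite [(tau + N)%N]addnC -addSn leq_add2r.
by rewrite wp //= nth_drop [(tau + t)%N]addnC.
Qed.

Lemma time_average_ext (S : {set {set {set G}}}) (w w' : nat -> worm G) :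
  (forall t, (t <= tau + N)%N -> w t = w' t) ->
  time_average R tau N S w = time_average R tau N S w'.
Proof.
move=> H; congr (_ * _); apply: eq_big_nat => t /andP[_ tT].
by rewrite H.
Qed.

(** Start and sampling contribute delta / 4 each. *)
Lemma time_average_deviation (S : {set {set {set G}}}) :
  2 * x ^+ k / n ^+ 2 <= ps_measure x S ->
  \sum_(w : {ffun 'I_(tau + N).+1 -> worm G} |
      ~~ (`|time_average R tau N S (trajectory w) - ps_measure x S| <= theta * ps_measure x S))
     traj_prob x (tau + N) (trajectory w) <= delta / 2.
Proof.
move=> qS; set q := ps_measure x S in qS *.
case/andP: (delta01) => d0 _.
have n0 : 0 < n by move: n2; lra.
have q0 : 0 < q by apply: lt_le_trans qS; rewrite divr_gt0 ?exprn_gt0 // mulr_gt0.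
set T := 4 * Dmax * m * n ^+ 2.
have T1 : 1 <= T.
  have ge1M (u v : R) : 1 <= u -> 1 <= v -> 1 <= u * v by move=> *; nra.
  by rewrite !ge1M ?exprn_ege1 // ?ler1n //; move: n2; lra.
have inv_le1 : (2 * T)^-1 <= 1 by rewrite invf_le1; move: T1; lra.
have d4 : 0 <= delta / 4 by lra.
have d2 : delta / 4 + delta / 4 <= delta / 2 by lra.
have h0 : 0 <= 2^-1 :> R by lra.
have h1 : 2^-1 <= 1 :> R by lra.
have pm0 := ps_mass_gt0 x01 n_gt0.
rewrite (sum_traj_prob x (fun w : {ffun 'I_(tau + N).+1 -> worm G} =>
  ~~ (`|time_average R tau N S (trajectory w) - q| <= theta * q))).
have H : ((1 - (2 * T)^-1) ^+ tau) ^+ 2 <= ps_mass x (worm0 G) * (delta / 4) ^+ 2.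
  apply: (@le_trans _ _ ((2^-1 ^+ #|edges G| * (delta / 4)) ^+ 2)).
    apply: lerXn2r; rewrite ?nnegrE.
    - by rewrite exprn_ge0 // subr_ge0.
    - by rewrite mulr_ge0 // exprn_ge0.
    exact: contraction_power T1 n2 delta01 burn_in_ge.
  rewrite exprMn; apply: ler_wpM2r; first exact: sqr_ge0.
  apply: le_trans (ps_mass_worm0 x01 edge).
  by rewrite expr2 ler_piMr ?exprn_ge0 ?exprn_ile1.
have := deviation_bound (fun a b => @worm_matrix_ge0 R G x x01 a b n_gt0)
  (@worm_matrix_sum R G x) (fun a => ltW (pm0 a)) (ps_mass_sum x01 n_gt0)
  (@ps_mass_balance R G x x01) (fun a => @worm_matrix_lazy R G x x01 a n_gt0)
  T1 (worm_poincare x01 n_gt0) (fun a => val a \in S)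
  (mulr_gt0 theta_gt0 q0) sample_size_gt0 d4 H (pm0 _).
rewrite -ps_measure_avg -/q => dev.
have cheb := chebyshev_numeric n2 D1 m1 d0 theta_gt0 y0 qS sample_size_ge.
apply: le_trans d2.
apply: le_trans (_ : delta / 4 + 4 * T * q / (N%:R * (theta * q) ^+ 2) <= _); last first.
  by rewrite lerD2l.
apply: le_trans dev.
rewrite le_eqVlt; apply/orP; left; apply/eqP; apply: path_mean_ext => p sp.
rewrite -ltNge (@time_averageE S _ (worm0 G) p) // => t tT.
by rewrite /trajectory ffunE inordK.
Qed.

Lemma estimator_deviation (beta : R) (u v : G) : 0 < beta -> x = tanh beta ->
  connected_graph G -> (gdist u v <= k)%N -> u != v ->
  \sum_(w : {ffun 'I_(tau + N).+1 -> worm G} |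
     ~~ (`|worm_estimator R tau N u v (trajectory w) - two_point beta u v|
          <= eps * two_point beta u v))
    traj_prob x (tau + N) (trajectory w) <= delta.
Proof.
move=> b0 xE Gc duv uv; have n0 : 0 < n by move: n2; lra.
have dC := time_average_deviation (ps_measure_C0_ge x01 edge k).
have dU := time_average_deviation (ps_measure_Cuv_ge x01 edge Gc uv duv).
have -> : delta = delta / 2 + delta / 2 by lra.
apply: (traj_prob_union x01 n_gt0) dU dC => w hU hC.
have Z0 := normalizer_gt0 x01 n_gt0.
have x_gt0 : 0 < x by case/andP: x01.
have l0 := lambda_gt0 G x_gt0.
have E : two_point beta u v = n / 2 * (ps_measure x (Cuv u v) / ps_measure x (C0 G)).
  rewrite two_pointE // -xE ps_measure_Cuv // ps_measure_C0 //.
  by rewrite -/n; field; rewrite !gt_eqF.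
have pos k' : 0 < 2 * x ^+ k' / n ^+ 2 by rewrite divr_gt0 ?mulr_gt0 ?exprn_gt0.
rewrite E; apply: ratio_error => //.
- exact: lt_le_trans (pos k) (ps_measure_Cuv_ge x01 edge Gc uv duv).
- exact: lt_le_trans (pos k) (ps_measure_C0_ge x01 edge k).
Qed.

Lemma running_time : (N + tau)%:R <=
  166 * (eps ^- 2 * delta^-1 * Dmax * m * n ^+ 6 * x ^- k).
Proof.
case/andP: (eps01) => e0 e1; case/andP: (delta01) => d0 d1; case/andP: (x01) => x0 x1.
have n0 : 0 <= n by move: n2; lra.
have m0 : 0 <= m by move: m1; lra.
have D0 : 0 <= Dmax by move: D1; lra.
have i0 : 1 <= 4 * delta^-1 by rewrite ler_pdivlMr // mul1r; lra.
have L0 : 0 <= ln 2 + ln (4 * delta^-1) / m.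
  by rewrite addr_ge0 ?divr_ge0 ?ln_ge0 //; lra.
have NE := absz_ceil_le (_ : 0 <= 16 * eps ^- 2 * (2 + eps) ^+ 2 * delta^-1
   * Dmax * m * n ^+ 6 * x ^- k).
have tE := absz_ceil_le (_ : 0 <= 4 * (ln 2 + ln (4 * delta^-1) / m)
   * Dmax * m ^+ 2 * n ^+ 4).
rewrite natrD; apply: le_trans (lerD (NE _) (tE _)) _.
- by rewrite !mulr_ge0 ?invr_ge0 ?exprn_ge0 //; lra.
- by rewrite !mulr_ge0 ?exprn_ge0.
apply: base_bound => //.
- by rewrite -natrX ler_nat card_edges_le.
- by rewrite y0 exprn_ile1 // ltW.
- by have := @le_ln1Dx R 1; rewrite (_ : 1 + 1 = 2) //; apply; lra.
- have := @le_ln1Dx R (4 * delta^-1 - 1).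
  rewrite (_ : 1 + (4 * delta^-1 - 1) = 4 * delta^-1); last by ring.
  by move=> H; apply: le_trans (H _) _; lra.
Qed.

End Simulation.

(** * The approximation scheme *)

Section Conclusion.
Context (R : realType).

Lemma estimators_approximate (G : sgraph) (beta eps delta : R) (k : nat)
    (d : measure_display) (Om : measurableType d) (P : probability Om R)
    (X : nat -> Om -> worm G) (u v : G) :
  connected_graph G -> (1 <= #|edges G|)%N ->
  0 < beta -> 0 < eps < 1 -> 0 < delta < 1 -> (gdist u v <= k)%N ->
  let x := tanh beta in
  let tau := burn_in G delta in
  let N := sample_size G x eps delta k in
  is_worm_process P x X ->
  [/\ is_approximation P
        (fun o => time_average R tau N (Cuv u v) (fun t => X t o))
        (eps / (2 + eps)) (delta / 2) (ps_measure x (Cuv u v)),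
      is_approximation P
        (fun o => time_average R tau N (C0 G) (fun t => X t o))
        (eps / (2 + eps)) (delta / 2) (ps_measure x (C0 G))
    & u != v ->
      is_approximation P
        (fun o => worm_estimator R tau N u v (fun t => X t o))
        eps delta (two_point beta u v)].
Proof.
move=> Gc edge b0 eps01 delta01 duv x tau N PX.
have x01 : 0 < x < 1 := tanh_bounds b0.
have n_gt0 : (0 < #|G|)%N := ltnW (card_vertices_ge2 edge).
have ext := @time_average_ext R G x eps delta k.
split.
- have [uv|uv] := eqVneq u v; last first.
    apply: (process_approximation (Y := time_average R tau N (Cuv u v)) PX (ext _)).
    exact: time_average_deviation (ps_measure_Cuv_ge x01 edge Gc uv duv).
  (* no worm has the boundary [set u; u], so that both sides vanish *)
  rewrite -uv {uv duv}.
  have -> : ps_measure x (Cuv u u) = 0.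
    by rewrite /ps_measure big_pred0 // => a; apply: worm_notin_Cuu.
  rewrite /is_approximation [X in P X](_ : _ = setT).
    by rewrite probability_setT lee_fin; case/andP: delta01; lra.
  apply/seteqP; split=> // o _ /=; rewrite mulr0 subr0 /time_average big1 ?mulr0 ?normr0 //.
  by move=> t _; rewrite worm_notin_Cuu.
- apply: (process_approximation (Y := time_average R tau N (C0 G)) PX (ext _)).
  exact: time_average_deviation (ps_measure_C0_ge x01 edge k).
- move=> uv.
  apply: (process_approximation (Y := worm_estimator R tau N u v) PX) => [f f' H|].
    by rewrite /worm_estimator (ext _ _ _ H) (ext (C0 G) _ _ H).
  exact: estimator_deviation.
Qed.

(** The maximum degree is at most n and the number of edges at most n^2, so the
    running time is at most a constant times n^9 eps^-2 delta^-1. *)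
Lemma worm_algorithm_fpras (k : nat) (beta : R) : 0 < beta ->
  is_fpras (@rp_size k) (restricted_correlation beta) (@worm_algorithm R k beta).
Proof.
move=> b0; have x01 := tanh_bounds b0; set x := tanh beta in x01.
split=> [i eps delta eps01 delta01|].
  have edge := rp_edge i; have n_gt0 := ltnW (card_vertices_ge2 edge).
  split; first by split=> [w|]; [exact: traj_prob_ge0|exact: traj_prob_sum].
  rewrite /is_approximation /run_prob lee_fin /=.
  pose good (w : {ffun 'I_(burn_in (rp_graph i) delta
        + sample_size (rp_graph i) x eps delta k).+1 -> worm (rp_graph i)}) :=
    `|(if rp_u i == rp_v i then 1
       else worm_estimator R (burn_in (rp_graph i) delta)
              (sample_size (rp_graph i) x eps delta k) (rp_u i) (rp_v i) (trajectory w))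
      - two_point beta (rp_u i) (rp_v i)| <= eps * two_point beta (rp_u i) (rp_v i).
  rewrite [leRHS](eq_bigl good) => [|w]; last by apply/idP/idP; rewrite in_setE.
  apply: traj_prob_compl; rewrite /good.
  have [uv|uv] := eqVneq (rp_u i) (rp_v i).
    rewrite big_pred0 => [|w]; first by case/andP: delta01 => /ltW.
    by rewrite uv two_point_diag subrr normr0 mulr1 ltW //; case/andP: eps01.
  by apply: estimator_deviation => //; [exact: rp_connected|exact: rp_dist].
exists ((166 * x ^- k)%:P%:P%:P * 'X^9 * ('X^2)%:P * 'X%:P%:P) => i eps delta eps01 delta01.
set G := rp_graph i; have edge := rp_edge i.
apply: le_trans (running_time k x01 edge eps01 delta01) _.
rewrite !(horner_exp, hornerC, hornerX, hornerM) /rp_size -/G.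
case/andP: eps01 => e0 _; case/andP: delta01 => d0 _; case/andP: x01 => x_gt0 _.
have D_le : (max_degree G)%:R <= #|G|%:R :> R by rewrite ler_nat max_degree_le.
have m_le : #|edges G|%:R <= #|G|%:R ^+ 2 :> R by rewrite -natrX ler_nat card_edges_le.
have mD : (max_degree G)%:R * #|edges G|%:R <= #|G|%:R ^+ 3 :> R.
  by rewrite exprS ler_pM.
have y_ge0 : 0 <= x ^- k by rewrite invr_ge0 exprn_ge0 ?ltW.
rewrite [leRHS](_ : _ = 166 * (eps ^- 2 * delta^-1 * #|G|%:R ^+ 3 * #|G|%:R ^+ 6 * x ^- k));
  last by rewrite exprVn; move: (x ^- k) (eps ^- 2) => y z; ring.
rewrite ler_wpM2l // ler_wpM2r // ler_wpM2r ?exprn_ge0 //.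
by rewrite -[leLHS]mulrA ler_wpM2l // mulr_ge0 ?invr_ge0 ?exprn_ge0 ?(ltW e0) ?(ltW d0).
Qed.

End Conclusion.

Theorem mainTheorem3 (R : realType) :
  (exists2 C : R, 0 < C &
   forall (G : sgraph) (beta eps delta : R) (k : nat),
     connected_graph G -> (1 <= #|edges G|)%N ->
     0 < beta -> 0 < eps < 1 -> 0 < delta < 1 ->
     let x := tanh beta in
     let tau := burn_in G delta in
     let N := sample_size G x eps delta k in
     (forall (d : measure_display) (Om : measurableType d)
             (P : probability Om R) (X : nat -> Om -> worm G),
        is_worm_process P x X ->
        forall u v : G, (gdist u v <= k)%N ->
        [/\ is_approximation P
              (fun o => time_average R tau N (Cuv u v) (fun t => X t o))
              (eps / (2 + eps)) (delta / 2) (ps_measure x (Cuv u v)),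
            is_approximation P
              (fun o => time_average R tau N (C0 G) (fun t => X t o))
              (eps / (2 + eps)) (delta / 2) (ps_measure x (C0 G))
          & u != v ->
            is_approximation P
              (fun o => worm_estimator R tau N u v (fun t => X t o))
              eps delta (two_point beta u v)]) /\
     (N + tau)%:R <= C * (eps ^- 2 * delta^-1 * (max_degree G)%:R
                          * #|edges G|%:R * #|G|%:R ^+ 6 * x ^- k))
  /\
  (forall (k : nat) (beta : R), 0 < beta ->
     is_fpras (@rp_size k) (restricted_correlation beta)
              (@worm_algorithm R k beta)).
Proof.
split; last exact: worm_algorithm_fpras.
exists 166 => // G beta eps delta k Gc edge b0 eps01 delta01 x tau N; split.
  by move=> d Om P X PX u v duv; apply: estimators_approximate.
exact: running_time (tanh_bounds b0) edge eps01 delta01.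
Qed.
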